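(* Let $\mu\in\Omega$, $\beta\in[0,1)$ and $f\in G(\mu,\beta)$. Denote $f_0(z)=(1-z)^{\mu\beta}$, $z\in\Delta$. Then $f_0\prec f$. This subordination is sharp since $f_0\in G(\mu,\beta)$.
   Context: $\Delta$ is the open unit disk in $\mathbb{C}$ and $\mathrm{Hol}(\Delta,\mathbb{C})$ is the set of holomorphic functions $\Delta\to\mathbb{C}$. Let $\Omega=\{\lambda\in\mathbb{C}: |\lambda-1|\le 1,\ \lambda\ne 0\}$. For $\mu\in\Omega$ and $\beta\in[0,1)$, the class $G(\mu,\beta)$ ($\mu$-spirallike functions of order $\beta$ with respect to a boundary point) consists of all univalent (injective holomorphic) functions $f\in\mathrm{Hol}(\Delta,\mathbb{C})$ with $f(0)=1$ such that $$\mathrm{Re}\left(\frac{2}{\mu}\cdot\frac{zf'(z)}{f(z)}+\frac{1+z}{1-z}\right)>\beta,\quad z\in\Delta.$$ For $s_1,s_2\in\mathrm{Hol}(\Delta,\mathbb{C})$, $s_1$ is subordinate to $s_2$, written $s_1\prec s_2$, if there is a holomorphic function $\omega$ on $\Delta$ with $|\omega(z)|\le|z|$ for all $z\in\Delta$ such that $s_1=s_2\circ\omega$. The power $(1-z)^{\mu\beta}$ is taken with the branch equal to $1$ at $z=0$.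
   Formalization: The claim that f_0 ∈ G(μ,β) is stated only for β > 0, since for β = 0 the function f_0 is the constant 1, which is not univalent; the sharpness is stated for all β as f_0 being the best common subordinant. *)

(* Defs.v *)
From Stdlib Require Import Reals Lra Psatz.
From Coquelicot Require Import Coquelicot.

Open Scope R_scope.

Definition in_disk (z : C) : Prop := Cmod z < 1.

(* Functions on the disk are total functions [C -> C]; every notion below only
   looks at their values in the open disk.  [ex_derive] is taken over the
   field C, so it means complex differentiability. *)
Definition holomorphic_disk (f : C -> C) : Prop :=
  forall z : C, in_disk z ->
    ex_derive (K := C_AbsRing) (V := C_NormedModule) f z.

Definition univalent_disk (f : C -> C) : Prop :=
  holomorphic_disk f /\
  forall z w : C, in_disk z -> in_disk w -> f z = f w -> z = w.

Definition Omega (lam : C) : Prop :=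
  Cmod (lam - RtoC 1)%C <= 1 /\ lam <> RtoC 0.

(* [f z <> 0] makes explicit that the quotient [z f'(z) / f(z)] is defined on
   the whole disk, since division in Coquelicot is total. *)
Definition classG (mu : C) (beta : R) (f : C -> C) : Prop :=
  univalent_disk f /\
  f (RtoC 0) = RtoC 1 /\
  (forall z : C, in_disk z -> f z <> RtoC 0) /\
  (forall z : C, in_disk z ->
     beta < Re (RtoC 2 / mu * (z * C_derive f z / f z)
                + (RtoC 1 + z) / (RtoC 1 - z))%C).

Definition subordinate (s1 s2 : C -> C) : Prop :=
  holomorphic_disk s1 /\ holomorphic_disk s2 /\
  exists omega : C -> C,
    holomorphic_disk omega /\
    (forall z : C, in_disk z -> Cmod (omega z) <= Cmod z) /\
    (forall z : C, in_disk z -> s1 z = s2 (omega z)).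

Definition Cexp (z : C) : C :=
  (exp (Re z) * cos (Im z), exp (Re z) * sin (Im z)).

(* The principal logarithm on the half-plane [0 < Re w] (and only there),
   which contains [1 - z] for every z in the unit disk. *)
Definition Clog (w : C) : C := (ln (Cmod w), atan (Im w / Re w)).

(* The branch of (1 - z)^a equal to 1 at z = 0. *)
Definition pow_one_minus (a z : C) : C := Cexp (a * Clog (RtoC 1 - z))%C.

Definition f0 (mu : C) (beta : R) (z : C) : C :=
  pow_one_minus (mu * RtoC beta)%C z.

Lemma Cexp_Clog (w : C) : 0 < Re w -> Cexp (Clog w) = w.
Proof.
destruct w as [x y]; unfold Cexp, Clog, Cmod; simpl; intros Hx.
assert (H1 : 0 < 1 + (y / x)²) by (pose proof (Rle_0_sqr (y / x)); lra).
assert (Hs : sqrt (x * (x * 1) + y * (y * 1)) = x * sqrt (1 + (y / x)²)).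
{ replace (x * (x * 1) + y * (y * 1)) with (x * x * (1 + (y / x)²))
    by (unfold Rsqr; field; lra).
  rewrite sqrt_mult by nra. now rewrite sqrt_square by lra. }
assert (H2 : 0 < sqrt (1 + (y / x)²)) by now apply sqrt_lt_R0.
rewrite Hs, exp_ln by nra.
rewrite cos_atan, sin_atan.
f_equal; field; lra.
Qed.

Lemma one_minus_disk_Re (z : C) : in_disk z -> 0 < Re (RtoC 1 - z)%C.
Proof.
unfold in_disk; intros Hz.
pose proof (re_le_Cmod z) as H.
destruct z as [x y]; simpl in *.
pose proof (Rle_abs x); lra.
Qed.

Lemma pow_one_minus_0 (a : C) : pow_one_minus a (RtoC 0) = RtoC 1.
Proof.
unfold pow_one_minus.
replace (RtoC 1 - RtoC 0)%C with (RtoC 1) by ring.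
replace (Clog (RtoC 1)) with (RtoC 0).
- rewrite Cmult_0_r; unfold Cexp; simpl.
  now rewrite exp_0, cos_0, sin_0, Rmult_1_r, Rmult_0_r.
- unfold Clog; rewrite Cmod_1, ln_1; simpl.
  unfold Rdiv; now rewrite Rmult_0_l, atan_0.
Qed.

(* Main.v *)
Require Import Defs.
From Stdlib Require Import Reals Lra Psatz ClassicalEpsilon.
From Coquelicot Require Import Coquelicot.

(** Put [X = z f' / (mu f) + z / (1 - z)].  The defining inequality says
    [Re X > - (1 - beta) / 2], and Schwarz's lemma turns this into
    [|X| <= |z| |X + 1 - beta|] ([logder_bound]).  Let [0 < beta].  In the
    coordinate [x = 1 / (1 - u)], which maps the disk [|u| <= r] to a round
    disk, the bound at a point [w] with [|w| = r] has this meaning: if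
    [w f' w / f w] is [m] times [zeta f0' zeta / f0 zeta], with [m] between
    [0] and [1], then [1 / (1 - w)] is a convex combination of a point of the
    disk, of [1 / (1 - zeta)] and of the interior point [1].  As [1 / (1 - w)]
    is on the boundary, this cannot happen if [|zeta| < |w|]
    ([logarithmic_derivative_avoids]).

    For [m = 0] this says that [f'] has no zero off the origin; the origin is
    treated by a limit ([classG_derive_0]).  So [f] is open, its inverse is
    holomorphic, and the subordinating function must be [omega = f^-1 o f0].
    That it is defined on the whole disk with [|omega z| <= |z|] is a
    continuity argument in the radius: fix [K > 1] and suppose that
    [|omega z| <= K |z|] holds on a closed disk.  If equality held at a
    boundary point [z0], Jack's lemma would give
    [z0 f0' z0 = k w0 f' w0] with [w0 = omega z0] and [k >= 1], the excluded
    situation with [m = 1 / k].  Hence the inequality is strict on the circle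
    and persists on a slightly larger disk ([attained_on_disk]).  Finally
    [K] tends to [1].  When [beta = 0], [f0] is the constant [1] and
    [omega = 0].

    Schwarz's lemma has to be applied to a function built from [f'], about
    which only its existence is known.  Two devices avoid proving that [f'] is
    holomorphic.  First, [X] is replaced by its average over short arcs
    [{z e^{is} : 0 <= s <= t}]: the average is a difference quotient of
    logarithms of [f], hence holomorphic in [z], and the real mean value theorem
    transfers the lower bound on the real part ([arc_average_bound]).  Second,
    the maximum principle is derived from Goursat's theorem on rectangles in
    exponential coordinates, which gives the mean value property at once
    ([circle_mean]), with no Cauchy formula.

    For sharpness, [f0] belongs to the class when [beta > 0], because
    [Re (1 / mu) >= 1 / 2] on [Omega] makes it injective.  When [beta = 0],
    [f0] is the constant [1]; the class then contains all [f0 mu b] with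
    [0 < b < 1], which tend to [1] as [b] tends to [0], so a function
    subordinate to all of them is [1]. *)


(** * Complex arithmetic and complex derivatives *)

Notation is_cderive f z l :=
  (is_derive (K := C_AbsRing) (V := C_NormedModule) f z l).

Lemma Rdiv_lt_iff (a b c : R) : 0 < b -> (a / b < c <-> a < c * b).
Proof.
  intros Hb. assert (E : a = a / b * b) by (field; apply Rgt_not_eq; auto).
  split; intros H; [rewrite E; apply Rmult_lt_compat_r; auto|].
  apply Rmult_lt_reg_r with b; auto. rewrite <- E; auto.
Qed.

Lemma Rdiv_le_iff (a b c : R) : 0 < b -> (a / b <= c <-> a <= c * b).
Proof.
  intros Hb. assert (E : a = a / b * b) by (field; apply Rgt_not_eq; auto).
  split; intros H; [rewrite E; apply Rmult_le_compat_r; lra|].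
  apply Rmult_le_reg_r with b; auto. rewrite <- E; auto.
Qed.

Lemma Cmod_sqr (z : C) : Cmod z ^ 2 = Re z ^ 2 + Im z ^ 2.
Proof. apply Cmod2_alt. Qed.

Lemma Cmod_rect (x y : R) : Cmod (x, y) <= Rabs x + Rabs y.
Proof.
  replace (x, y) with (RtoC x + RtoC y * Ci)%C
    by (apply injective_projections; simpl; ring).
  eapply Rle_trans; [apply Cmod_triangle|].
  rewrite Cmod_mult, Cmod_Ci, !Cmod_R; lra.
Qed.

Lemma im_le_Cmod (z : C) : Rabs (Im z) <= Cmod z.
Proof.
  pose proof (Rmax_Cmod z) as H; pose proof (Rmax_r (Rabs (fst z)) (Rabs (snd z))).
  destruct z; simpl in *; lra.
Qed.

Lemma Cmod_minus_sym (z w : C) : Cmod (z - w)%C = Cmod (w - z)%C.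
Proof. rewrite <- Cmod_opp; f_equal; ring. Qed.

Lemma Cmod_minus_ge (z w : C) : Cmod z - Cmod w <= Cmod (z - w)%C.
Proof.
  pose proof (Cmod_triangle (z - w) w) as H.
  replace (z - w + w)%C with z in H by ring. lra.
Qed.

Lemma Cmod_minus_triangle (z w v : C) :
  Cmod (z - v)%C <= Cmod (z - w)%C + Cmod (w - v)%C.
Proof. replace (z - v)%C with ((z - w) + (w - v))%C by ring; apply Cmod_triangle. Qed.

Lemma Cmod_small_eq (z w : C) : (forall eps, 0 < eps -> Cmod (z - w)%C <= eps) -> z = w.
Proof.
  intros H. assert (H0 : Cmod (z - w)%C = 0).
  { pose proof (Cmod_ge_0 (z - w)%C).
    destruct (Rle_lt_dec (Cmod (z - w)%C) 0); [lra|].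
    specialize (H (Cmod (z - w)%C / 2)); lra. }
  apply Cmod_eq_0 in H0. replace z with ((z - w) + w)%C by ring. rewrite H0; ring.
Qed.

Lemma one_minus_disk_neq0 (z : C) : in_disk z -> (RtoC 1 - z)%C <> RtoC 0.
Proof. intros Hz H; apply one_minus_disk_Re in Hz; rewrite H in Hz; simpl in Hz; lra. Qed.

Definition ccont (f : C -> C) (z : C) : Prop :=
  forall eps, 0 < eps -> exists del, 0 < del /\
    forall w, Cmod (w - z)%C < del -> Cmod (f w - f z)%C < eps.

Lemma locally_Cmod (z : C) (P : C -> Prop) :
  locally (T := AbsRing_UniformSpace C_AbsRing) z P <->
  exists del, 0 < del /\ forall w, Cmod (w - z)%C < del -> P w.
Proof.
  split.
  - intros [d Hd]. exists d; split; [apply cond_pos|]. intros w Hw. apply Hd. exact Hw.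
  - intros [d [Hd H]]. exists (mkposreal d Hd). intros w Hw. apply H. exact Hw.
Qed.

Lemma is_cderive_eps (f : C -> C) (z l : C) :
  is_cderive f z l <->
  forall eps, 0 < eps -> exists del, 0 < del /\
    forall w, Cmod (w - z)%C < del ->
      Cmod (f w - f z - l * (w - z))%C <= eps * Cmod (w - z)%C.
Proof.
  split.
  - intros [_ H] eps He.
    specialize (H z (fun P HP => HP) (mkposreal _ He)).
    apply locally_Cmod in H. destruct H as [d [Hd H]].
    exists d; split; auto. intros w Hw. specialize (H w Hw).
    rewrite (Cmult_comm l). exact H.
  - intros H. split; [apply is_linear_scal_l|].
    intros x Hx. apply (is_filter_lim_locally_unique (V := AbsRing_NormedModule C_AbsRing)) in Hx.
    rewrite <- Hx. intros [eps He]. apply locally_Cmod.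
    destruct (H eps He) as [d [Hd H']]. exists d; split; auto.
    intros w Hw. specialize (H' w Hw). rewrite (Cmult_comm l) in H'. exact H'.
Qed.

Lemma is_cderive_ccont (f : C -> C) (z l : C) : is_cderive f z l -> ccont f z.
Proof.
  intros H eps He.
  destruct (proj1 (is_cderive_eps f z l) H 1 Rlt_0_1) as [d [Hd H1]].
  pose proof (Cmod_ge_0 l).
  assert (Hp : 0 < eps / (Cmod l + 2)) by (apply Rdiv_lt_0_compat; lra).
  exists (Rmin d (eps / (Cmod l + 2))). split; [apply Rmin_pos; auto|].
  intros w Hw.
  assert (Cmod (w - z)%C < d) by (eapply Rlt_le_trans; [apply Hw|apply Rmin_l]).
  assert (H3 : Cmod (w - z)%C < eps / (Cmod l + 2))
    by (eapply Rlt_le_trans; [apply Hw|apply Rmin_r]).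
  apply (Rmult_lt_compat_r (Cmod l + 2)) in H3; [|lra].
  unfold Rdiv in H3; rewrite Rmult_assoc, Rinv_l, Rmult_1_r in H3 by lra.
  specialize (H1 w H2).
  replace (f w - f z)%C with ((f w - f z - l * (w - z)) + l * (w - z))%C by ring.
  eapply Rle_lt_trans; [apply Cmod_triangle|]. rewrite Cmod_mult.
  pose proof (Cmod_ge_0 (w - z)%C). nra.
Qed.

Lemma is_cderive_ext_near (f g : C -> C) (z l : C) (del : R) :
  0 < del -> (forall w, Cmod (w - z)%C < del -> f w = g w) ->
  is_cderive f z l -> is_cderive g z l.
Proof.
  intros Hd H Hf. eapply (is_derive_ext_loc (K := C_AbsRing) (V := C_NormedModule) f g); [|exact Hf].
  apply (proj2 (locally_Cmod z (fun t => f t = g t))).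
  exists del; auto.
Qed.

(** The complex numbers carry two normed-module structures, with the same norm
    but different balls; the general product and chain rules are stated for
    the one induced by the absolute value. *)
Lemma is_cderive_abs (f : C -> C) (z l : C) :
  is_derive (K := C_AbsRing) (V := AbsRing_NormedModule C_AbsRing) f z l <->
  is_cderive f z l.
Proof.
  split; intros [H0 H1]; (split; [apply is_linear_scal_l|exact H1]).
Qed.

Lemma is_cderive_const (a z : C) : is_cderive (fun _ => a) z (RtoC 0).
Proof. apply (is_derive_const (K := C_AbsRing) (V := C_NormedModule)). Qed.

Lemma is_cderive_id (z : C) : is_cderive (fun w => w) z (RtoC 1).
Proof.
  apply is_cderive_eps. intros eps He. exists 1; split; [lra|]. intros w _.
  replace (w - z - 1 * (w - z))%C with (RtoC 0) by ring.
  rewrite Cmod_0. apply Rmult_le_pos; [lra|apply Cmod_ge_0].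
Qed.

Lemma is_cderive_plus (f g : C -> C) (z l m : C) :
  is_cderive f z l -> is_cderive g z m ->
  is_cderive (fun w => f w + g w)%C z (l + m)%C.
Proof. apply (is_derive_plus (K := C_AbsRing) (V := C_NormedModule)). Qed.

Lemma is_cderive_minus (f g : C -> C) (z l m : C) :
  is_cderive f z l -> is_cderive g z m ->
  is_cderive (fun w => f w - g w)%C z (l - m)%C.
Proof. apply (is_derive_minus (K := C_AbsRing) (V := C_NormedModule)). Qed.

Lemma is_cderive_mult (f g : C -> C) (z l m : C) :
  is_cderive f z l -> is_cderive g z m ->
  is_cderive (fun w => f w * g w)%C z (l * g z + f z * m)%C.
Proof.
  intros Hf Hg. apply is_cderive_abs. apply is_cderive_abs in Hf. apply is_cderive_abs in Hg.
  apply (is_derive_mult (K := C_AbsRing) f g z l m Hf Hg).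
  intros; apply Cmult_comm.
Qed.

Lemma is_cderive_scal (a : C) (f : C -> C) (z l : C) :
  is_cderive f z l -> is_cderive (fun w => a * f w)%C z (a * l)%C.
Proof.
  intros Hf. pose proof (is_cderive_mult _ f z _ l (is_cderive_const a z) Hf) as H.
  replace (a * l)%C with (RtoC 0 * f z + a * l)%C by ring. exact H.
Qed.

Lemma is_cderive_comp (f g : C -> C) (z l m : C) :
  is_cderive f (g z) l -> is_cderive g z m ->
  is_cderive (fun w => f (g w)) z (l * m)%C.
Proof.
  intros Hf Hg. rewrite Cmult_comm. apply is_cderive_abs in Hg.
  exact (is_derive_comp (K := C_AbsRing) (V := C_NormedModule) f g z l m Hf Hg).
Qed.

(** The derivative of a right inverse is read off the composite: this covers
    the logarithm, the inverse of a univalent function, and the function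
    through which one function is subordinate to another. *)
Lemma is_cderive_lift (g phi h : C -> C) (z l m : C) (del : R) :
  0 < del -> (forall w, Cmod (w - z)%C < del -> g (phi w) = h w) ->
  ccont phi z -> is_cderive g (phi z) l -> l <> RtoC 0 -> is_cderive h z m ->
  is_cderive phi z (m / l)%C.
Proof.
  intros Hd Hgh Hc Hg Hl Hh. apply is_cderive_eps. intros eps He.
  set (L := Cmod l). assert (HL : 0 < L) by (apply Cmod_gt_0; auto).
  set (M := Cmod m). assert (HM : 0 <= M) by apply Cmod_ge_0.
  (* With D = phi w - phi z and d = w - z, the error eta in both expansions
     gives L |D| <= (M + eta) |d| + eta |D|, hence |D| <= 2 (M + 1) / L |d|. *)
  set (eta := Rmin (Rmin 1 (L / 2)) (eps * L / (1 + 2 * (M + 1) / L))).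
  assert (Hq : 0 < 1 + 2 * (M + 1) / L).
  { assert (0 < 2 * (M + 1) / L) by (apply Rdiv_lt_0_compat; lra). lra. }
  assert (Heta : 0 < eta).
  { unfold eta. repeat apply Rmin_pos; try lra. apply Rdiv_lt_0_compat; auto. nra. }
  assert (E1 : eta <= 1) by (unfold eta; eapply Rle_trans; [apply Rmin_l|apply Rmin_l]).
  assert (E2 : eta <= L / 2) by (unfold eta; eapply Rle_trans; [apply Rmin_l|apply Rmin_r]).
  assert (E3 : eta * (1 + 2 * (M + 1) / L) <= eps * L).
  { apply Rle_trans with (eps * L / (1 + 2 * (M + 1) / L) * (1 + 2 * (M + 1) / L)).
    - apply Rmult_le_compat_r; [lra|]. apply Rmin_r.
    - right. field. split; lra. }
  destruct (proj1 (is_cderive_eps _ _ _) Hg eta Heta) as [d1 [Hd1 H1]].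
  destruct (proj1 (is_cderive_eps _ _ _) Hh eta Heta) as [d2 [Hd2 H2]].
  destruct (Hc d1 Hd1) as [d3 [Hd3 H3]].
  exists (Rmin del (Rmin d2 d3)). split; [repeat apply Rmin_pos; auto|].
  intros w Hw.
  assert (Hw1 : Cmod (w - z)%C < del) by (eapply Rlt_le_trans; [apply Hw|apply Rmin_l]).
  assert (Hw2 : Cmod (w - z)%C < d2)
    by (eapply Rlt_le_trans; [apply Hw|eapply Rle_trans; [apply Rmin_r|apply Rmin_l]]).
  assert (Hw3 : Cmod (w - z)%C < d3)
    by (eapply Rlt_le_trans; [apply Hw|eapply Rle_trans; [apply Rmin_r|apply Rmin_r]]).
  specialize (H1 _ (H3 w Hw3)). specialize (H2 w Hw2).
  rewrite (Hgh w Hw1), (Hgh z) in H1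
    by (replace (z - z)%C with (RtoC 0) by ring; rewrite Cmod_0; auto).
  set (D := (phi w - phi z)%C) in *. set (d := (w - z)%C) in *.
  set (A := (h w - h z)%C) in *.
  assert (H4 : Cmod (l * D - m * d)%C <= eta * Cmod D + eta * Cmod d).
  { replace (l * D - m * d)%C with (- (A - l * D) + (A - m * d))%C by ring.
    eapply Rle_trans; [apply Cmod_triangle|]. rewrite Cmod_opp. lra. }
  assert (H5 : L * Cmod D <= M * Cmod d + Cmod (l * D - m * d)%C).
  { unfold L, M. rewrite <- !Cmod_mult.
    replace (l * D)%C with (m * d + (l * D - m * d))%C at 1 by ring. apply Cmod_triangle. }
  pose proof (Cmod_ge_0 D) as HD. pose proof (Cmod_ge_0 d) as Hd0.
  assert (H6 : L * Cmod D <= 2 * (M + 1) * Cmod d) by nra.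
  assert (H7 : Cmod D <= 2 * (M + 1) / L * Cmod d).
  { apply Rmult_le_reg_l with L; auto.
    replace (L * (2 * (M + 1) / L * Cmod d)) with (2 * (M + 1) * Cmod d) by (field; lra). auto. }
  replace (D - m / l * d)%C with ((l * D - m * d) / l)%C by (field; auto).
  rewrite Cmod_div by auto. fold L. apply Rdiv_le_iff; auto.
  apply Rle_trans with (eta * (1 + 2 * (M + 1) / L) * Cmod d); nra.
Qed.

Lemma is_cderive_inv (z : C) : z <> RtoC 0 -> is_cderive (fun w => / w)%C z (- / (z * z))%C.
Proof.
  intros Hz.
  (* The error is 1/w - 1/z + (w - z)/z^2 = (w - z)^2 / (w z^2). *)
  apply is_cderive_eps. intros eps He.
  set (L := Cmod z). assert (HL : 0 < L) by (apply Cmod_gt_0; auto).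
  assert (HL3 : 0 < L * L * L) by (repeat apply Rmult_lt_0_compat; auto).
  exists (Rmin (L / 2) (eps * (L * L * L) / 2)). split.
  { apply Rmin_pos; [lra|]. assert (0 < eps * (L * L * L)) by (apply Rmult_lt_0_compat; auto). lra. }
  intros w Hw.
  assert (H1 : Cmod (w - z)%C < L / 2) by (eapply Rlt_le_trans; [apply Hw|apply Rmin_l]).
  assert (H2 : Cmod (w - z)%C < eps * (L * L * L) / 2) by (eapply Rlt_le_trans; [apply Hw|apply Rmin_r]).
  pose proof (Cmod_minus_ge z w) as H3. rewrite Cmod_minus_sym in H3. fold L in H3.
  assert (Hw0 : w <> RtoC 0) by (apply Cmod_gt_0; lra).
  replace (/ w - / z - - / (z * z) * (w - z))%C
    with ((w - z) * ((w - z) / (w * (z * z))))%C by (field; auto).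
  rewrite Cmod_mult, Rmult_comm. apply Rmult_le_compat_r; [apply Cmod_ge_0|].
  rewrite Cmod_div, !Cmod_mult by (repeat apply Cmult_neq_0; auto). fold L.
  assert (Hp : 0 < Cmod w * (L * L)) by (repeat apply Rmult_lt_0_compat; lra).
  apply Rdiv_le_iff; auto.
  assert (0 < eps * (L * L)) by (repeat apply Rmult_lt_0_compat; auto). nra.
Qed.

Lemma is_cderive_div (f g : C -> C) (z l m : C) :
  is_cderive f z l -> is_cderive g z m -> g z <> RtoC 0 ->
  is_cderive (fun w => f w / g w)%C z ((l * g z - f z * m) / (g z * g z))%C.
Proof.
  intros Hf Hg Hz.
  pose proof (is_cderive_comp (fun w => / w)%C g z _ m (is_cderive_inv _ Hz) Hg) as Hi.
  pose proof (is_cderive_mult f _ z l _ Hf Hi) as H. unfold Cdiv at 1.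
  replace ((l * g z - f z * m) / (g z * g z))%C
    with (l * / g z + f z * (- / (g z * g z) * m))%C by (field; auto). exact H.
Qed.


(** * Bisection of rectangles, and compactness of closed disks *)

(** The common core of the compactness of closed disks and of Goursat's theorem.
    The rectangles have corner [(x, y)] and sides [s * A], [s * B].  If [G]
    failed on one, it would fail on one of its quarters, and so on: these bad
    rectangles shrink to a point, around which small rectangles are good. *)
Lemma rect_induction (A B : R) (G : R -> R -> R -> Prop) (x0 y0 s0 : R) :
  0 <= A -> 0 <= B -> 0 < s0 ->
  (forall x y s, 0 < s ->
     G x y (s / 2) -> G (x + s / 2 * A) y (s / 2) ->
     G x (y + s / 2 * B) (s / 2) -> G (x + s / 2 * A) (y + s / 2 * B) (s / 2) ->
     G x y s) ->
  (forall p q, x0 <= p <= x0 + s0 * A -> y0 <= q <= y0 + s0 * B ->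
     exists del, 0 < del /\ forall x y s, 0 < s < del ->
       x0 <= x -> x + s * A <= x0 + s0 * A -> y0 <= y -> y + s * B <= y0 + s0 * B ->
       x <= p <= x + s * A -> y <= q <= y + s * B -> G x y s) ->
  G x0 y0 s0.
Proof.
  intros HA HB Hs0 Hquarter Hsmall. apply NNPP; intro Hbad.
  set (bad := fun t : R * R * R => 0 < snd t /\ ~ G (fst (fst t)) (snd (fst t)) (snd t)).
  assert (Hnext : forall t : {t | bad t}, exists t' : {t | bad t},
    let '(x, y, s) := proj1_sig t in let '(x', y', s') := proj1_sig t' in
    s' = s / 2 /\ x <= x' /\ x' + s' * A <= x + s * A /\
    y <= y' /\ y' + s' * B <= y + s * B).
  { intros [[[x y] s] [Hs HG]]; simpl in *.
    assert (Hh : 0 < s / 2) by lra.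
    assert (0 <= s / 2 * A) by (apply Rmult_le_pos; lra).
    assert (0 <= s / 2 * B) by (apply Rmult_le_pos; lra).
    destruct (classic (G x y (s / 2))) as [H1|H1];
      [|exists (exist _ (x, y, s / 2) (conj Hh H1)); simpl; lra].
    destruct (classic (G (x + s / 2 * A) y (s / 2))) as [H2|H2];
      [|exists (exist _ (x + s / 2 * A, y, s / 2) (conj Hh H2)); simpl; lra].
    destruct (classic (G x (y + s / 2 * B) (s / 2))) as [H3|H3];
      [|exists (exist _ (x, y + s / 2 * B, s / 2) (conj Hh H3)); simpl; lra].
    destruct (classic (G (x + s / 2 * A) (y + s / 2 * B) (s / 2))) as [H4|H4];
      [|exists (exist _ (x + s / 2 * A, y + s / 2 * B, s / 2) (conj Hh H4)); simpl; lra].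
    exfalso; apply HG; auto. }
  set (next := fun t => proj1_sig (constructive_indefinite_description _ (Hnext t))).
  assert (Hn : forall t, let '(x, y, s) := proj1_sig t in
    let '(x', y', s') := proj1_sig (next t) in
    s' = s / 2 /\ x <= x' /\ x' + s' * A <= x + s * A /\
    y <= y' /\ y' + s' * B <= y + s * B).
  { intros t. unfold next.
    exact (proj2_sig (constructive_indefinite_description _ (Hnext t))). }
  set (u := fun n => proj1_sig (Nat.iter n next (exist bad (x0, y0, s0) (conj Hs0 Hbad)))).
  set (X := fun n => fst (fst (u n))). set (Y := fun n => snd (fst (u n))).
  set (S := fun n => snd (u n)).
  assert (Hbadn : forall n, 0 < S n /\ ~ G (X n) (Y n) (S n)).
  { intros n. unfold S, X, Y, u. apply (proj2_sig (Nat.iter n next _)). }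
  assert (Hstep : forall n, S (n + 1)%nat = S n / 2 /\ X n <= X (n + 1)%nat /\
    X (n + 1)%nat + S (n + 1)%nat * A <= X n + S n * A /\ Y n <= Y (n + 1)%nat /\
    Y (n + 1)%nat + S (n + 1)%nat * B <= Y n + S n * B).
  { intros n. unfold S, X, Y, u. rewrite Nat.add_1_r. simpl.
    specialize (Hn (Nat.iter n next (exist bad (x0, y0, s0) (conj Hs0 Hbad)))).
    destruct (proj1_sig (Nat.iter n next _)) as [[x y] s].
    destruct (proj1_sig (next _)) as [[x' y'] s']. simpl. exact Hn. }
  assert (Hmono : forall n k, X n <= X (n + k)%nat /\
    X (n + k)%nat + S (n + k)%nat * A <= X n + S n * A /\ Y n <= Y (n + k)%nat /\
    Y (n + k)%nat + S (n + k)%nat * B <= Y n + S n * B).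
  { intros n k. induction k as [|k IH]; [rewrite Nat.add_0_r; lra|].
    specialize (Hstep (n + k)%nat). replace (n + Datatypes.S k)%nat with (n + k + 1)%nat by lia. lra. }
  assert (HS : forall n, S n = s0 / 2 ^ n).
  { induction n as [|n IH]; [unfold S, u; simpl; lra|].
    replace (Datatypes.S n) with (n + 1)%nat by lia.
    destruct (Hstep n) as [-> _]. rewrite IH, pow_add. field. apply pow_nonzero; lra. }
  assert (Hnest : forall n m, X n <= X m + S m * A /\ Y n <= Y m + S m * B).
  { intros n m.
    assert (0 <= S (n + m)%nat * A)
      by (apply Rmult_le_pos; auto; apply Rlt_le, (Hbadn (n + m)%nat)).
    assert (0 <= S (n + m)%nat * B)
      by (apply Rmult_le_pos; auto; apply Rlt_le, (Hbadn (n + m)%nat)).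
    pose proof (Hmono n m). pose proof (Hmono m n) as H2. rewrite (Nat.add_comm m n) in H2. lra. }
  destruct (completeness (fun r => exists n, r = X n)) as [p [Hp1 Hp2]].
  { exists (X 0%nat + S 0%nat * A). intros r [n ->]. apply Hnest. }
  { exists (X 0%nat), 0%nat; auto. }
  destruct (completeness (fun r => exists n, r = Y n)) as [q [Hq1 Hq2]].
  { exists (Y 0%nat + S 0%nat * B). intros r [n ->]. apply Hnest. }
  { exists (Y 0%nat), 0%nat; auto. }
  assert (Hp : forall n, X n <= p <= X n + S n * A).
  { intros n; split; [apply Hp1; exists n; auto|]. apply Hp2. intros r [m ->]. apply Hnest. }
  assert (Hq : forall n, Y n <= q <= Y n + S n * B).
  { intros n; split; [apply Hq1; exists n; auto|]. apply Hq2. intros r [m ->]. apply Hnest. }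
  destruct (Hsmall p q (Hp 0%nat) (Hq 0%nat)) as [del [Hdel HG]].
  assert (Hlim : exists n, S n < del).
  { destruct (pow_lt_1_zero (/ 2)) with (y := del / s0) as [n Hpow].
    - rewrite Rabs_right; lra.
    - apply Rdiv_lt_0_compat; auto.
    - exists n. specialize (Hpow n (le_n n)). rewrite Rabs_right in Hpow
        by (apply Rle_ge, pow_le; lra).
      rewrite HS. unfold Rdiv. rewrite <- pow_inv.
      apply (Rmult_lt_compat_l s0) in Hpow; auto.
      replace (s0 * (del / s0)) with del in Hpow by (field; lra). exact Hpow. }
  destruct Hlim as [n Hlt]. pose proof (Hmono 0%nat n) as H0. rewrite Nat.add_0_l in H0.
  apply (proj2 (Hbadn n)). apply HG; auto; try apply H0. split; auto. apply Hbadn.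
Qed.

(** Compactness of the closed disk as an induction on its subsets, by bisection
    of the circumscribed square; small squares around a point outside the
    disk meet it in the empty set. *)
Lemma disk_induction (r : R) (G : (C -> Prop) -> Prop) :
  0 < r ->
  (forall U V W Z : C -> Prop, G U -> G V -> G W -> G Z ->
     G (fun z => U z \/ V z \/ W z \/ Z z)) ->
  (forall U V : C -> Prop, (forall z, U z -> V z) -> G V -> G U) ->
  (forall z0, Cmod z0 <= r -> exists del, 0 < del /\
     G (fun z => Cmod z <= r /\ Cmod (z - z0)%C < del)) ->
  (G (fun z => False)) ->
  G (fun z => Cmod z <= r).
Proof.
  intros Hr Hun Hsub Hloc Hemp.
  set (sq := fun x y s (z : C) => Cmod z <= r /\ x <= Re z <= x + s /\ y <= Im z <= y + s).
  apply Hsub with (sq (-r) (-r) (2 * r)).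
  { intros z Hz. split; auto. pose proof (re_le_Cmod z) as H1. pose proof (im_le_Cmod z) as H2.
    pose proof (Rle_abs (Re z)). pose proof (Rle_abs (- Re z)) as H3. rewrite Rabs_Ropp in H3.
    pose proof (Rle_abs (Im z)). pose proof (Rle_abs (- Im z)) as H4. rewrite Rabs_Ropp in H4. lra. }
  apply (rect_induction 1 1 (fun x y s => G (sq x y s))); try lra.
  - intros x y s Hs H1 H2 H3 H4. eapply Hsub; [|exact (Hun _ _ _ _ H1 H2 H3 H4)].
    intros z [Hz [Hx Hy]]. unfold sq. rewrite !Rmult_1_r.
    destruct (Rle_dec (Re z) (x + s / 2)), (Rle_dec (Im z) (y + s / 2)).
    + left; repeat split; lra.
    + right; right; left; repeat split; lra.
    + right; left; repeat split; lra.
    + right; right; right; repeat split; lra.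
  - intros p q _ _. destruct (Rle_lt_dec (Cmod (p, q)) r) as [Hin|Hout].
    + destruct (Hloc _ Hin) as [del [Hdel HG]]. exists (del / 2); split; [lra|].
      intros x y s Hs _ _ _ _ Hx Hy. eapply Hsub; [|exact HG].
      intros z [Hz [Hzx Hzy]]. split; auto.
      eapply Rle_lt_trans with (Rabs (Re z - p) + Rabs (Im z - q)).
      { destruct z as [a b]; simpl. apply Cmod_rect. }
      assert (Rabs (Re z - p) <= s) by (apply Rabs_le; lra).
      assert (Rabs (Im z - q) <= s) by (apply Rabs_le; lra). lra.
    + exists ((Cmod (p, q) - r) / 2); split; [lra|].
      intros x y s Hs _ _ _ _ Hx Hy. eapply Hsub; [|exact Hemp].
      intros z [Hz [Hzx Hzy]].
      pose proof (Cmod_minus_ge (p, q) z) as H1.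
      assert (H2 : Cmod ((p, q) - z)%C <= Rabs (p - Re z) + Rabs (q - Im z)).
      { destruct z as [a b]; simpl. apply Cmod_rect. }
      assert (Rabs (p - Re z) <= s) by (apply Rabs_le; lra).
      assert (Rabs (q - Im z) <= s) by (apply Rabs_le; lra). lra.
Qed.

Lemma disk_max (phi : C -> R) (r : R) :
  0 < r ->
  (forall z, Cmod z <= r -> forall eps, 0 < eps -> exists del, 0 < del /\
     forall w, Cmod w <= r -> Cmod (w - z)%C < del -> phi w < phi z + eps) ->
  exists z, Cmod z <= r /\ forall w, Cmod w <= r -> phi w <= phi z.
Proof.
  intros Hr Hc. apply NNPP; intro Hno.
  assert (Hbig : forall z, Cmod z <= r -> exists w, Cmod w <= r /\ phi z < phi w).
  { intros z Hz. apply NNPP; intro H. apply Hno. exists z; split; auto.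
    intros w Hw. apply Rnot_lt_le. intro Hlt. apply H. exists w; auto. }
  assert (Hzero : Cmod (RtoC 0) <= r) by (rewrite Cmod_0; lra).
  (* Good sets are those on which phi stays below one of its values on the
     disk; if the disk itself is good, that value is below itself. *)
  destruct (disk_induction r (fun U => exists z1, Cmod z1 <= r /\
    forall z, U z -> Cmod z <= r -> phi z < phi z1)) as [z1 [Hz1 H1]]; auto.
  - intros U V W Z [a [Ha HU]] [b [Hb HV]] [c [Hc' HW]] [d [Hd HZ]].
    assert (Hm : exists m, Cmod m <= r /\
      phi a <= phi m /\ phi b <= phi m /\ phi c <= phi m /\ phi d <= phi m).
    { assert (Hm2 : forall s t, Cmod s <= r -> Cmod t <= r ->
        exists m, Cmod m <= r /\ phi s <= phi m /\ phi t <= phi m).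
      { intros s t Hs Ht. destruct (Rle_dec (phi s) (phi t)); [exists t|exists s]; repeat split; auto; lra. }
      destruct (Hm2 a b Ha Hb) as [m1 [Hm1 ?]]. destruct (Hm2 c d Hc' Hd) as [m2 [Hm2' ?]].
      destruct (Hm2 m1 m2 Hm1 Hm2') as [m [Hm ?]]. exists m; split; auto. lra. }
    destruct Hm as [m [Hm Hle]]. exists m; split; auto.
    intros z [H|[H|[H|H]]] Hz; [specialize (HU z H Hz)|specialize (HV z H Hz)|
      specialize (HW z H Hz)|specialize (HZ z H Hz)]; lra.
  - intros U V HUV [z1 [Hz1 H1]]. exists z1; auto.
  - intros z0 Hz0. destruct (Hbig z0 Hz0) as [z1 [Hz1 Hlt]].
    destruct (Hc z0 Hz0 (phi z1 - phi z0)) as [del [Hdel H]]; [lra|].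
    exists del; split; auto. exists z1; split; auto.
    intros z [_ Hz] Hzr. specialize (H z Hzr Hz). lra.
  - exists (RtoC 0); split; auto. intros z [].
  - specialize (H1 z1 Hz1 Hz1). lra.
Qed.

Lemma disk_uniform (r : R) (P : C -> R -> Prop) :
  0 < r ->
  (forall z d d', 0 < d' <= d -> P z d -> P z d') ->
  (forall z0, Cmod z0 <= r -> exists del, 0 < del /\
     forall z, Cmod z <= r -> Cmod (z - z0)%C < del -> P z del) ->
  exists del, 0 < del /\ forall z, Cmod z <= r -> P z del.
Proof.
  intros Hr Hmono Hloc.
  apply (disk_induction r (fun U => exists del, 0 < del /\ forall z, U z -> P z del)); auto.
  - intros U V W Z [a [Ha HU]] [b [Hb HV]] [c [Hc HW]] [d [Hd HZ]].
    exists (Rmin (Rmin a b) (Rmin c d)). split; [repeat apply Rmin_pos; auto|].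
    pose proof (Rmin_l (Rmin a b) (Rmin c d)). pose proof (Rmin_r (Rmin a b) (Rmin c d)).
    pose proof (Rmin_l a b). pose proof (Rmin_r a b). pose proof (Rmin_l c d). pose proof (Rmin_r c d).
    assert (0 < Rmin (Rmin a b) (Rmin c d)) by (repeat apply Rmin_pos; auto).
    intros z [Hz|[Hz|[Hz|Hz]]]; [apply Hmono with a|apply Hmono with b|
      apply Hmono with c|apply Hmono with d]; auto; lra.
  - intros U V HUV [d [Hd H]]. exists d; auto.
  - intros z0 Hz0. destruct (Hloc z0 Hz0) as [d [Hd H]]. exists d; split; auto.
    exists d; split; auto. intros z [H1 H2]. auto.
  - exists 1; split; [lra|]. intros z [].
Qed.


(** * Goursat's theorem on rectangles *)

Definition ex_cderive (f : C -> C) (z : C) : Prop :=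
  ex_derive (K := C_AbsRing) (V := C_NormedModule) f z.

Lemma ex_cderive_ccont (f : C -> C) (z : C) : ex_cderive f z -> ccont f z.
Proof. intros [l H]. exact (is_cderive_ccont f z l H). Qed.

Lemma continuous_along (L : C -> R) (G : C -> C) (gam : R -> C) (t0 : R) :
  (forall a b, Rabs (L a - L b) <= Cmod (a - b)%C) ->
  (forall t, Cmod (gam t - gam t0)%C <= Rabs (t - t0)) ->
  ccont G (gam t0) -> continuous (fun t => L (G (gam t))) t0.
Proof.
  intros HL Hg HG. apply continuity_pt_filterlim. intros eps He.
  destruct (HG eps He) as [d [Hd H]]. exists d; split; auto.
  intros t [_ Ht]. simpl in *. unfold Rdist in *.
  eapply Rle_lt_trans; [apply HL|]. apply H. eapply Rle_lt_trans; [apply Hg|exact Ht].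
Qed.

Lemma Re_lipschitz (a b : C) : Rabs (Re a - Re b) <= Cmod (a - b)%C.
Proof. exact (re_le_Cmod (a - b)%C). Qed.

Lemma Im_lipschitz (a b : C) : Rabs (Im a - Im b) <= Cmod (a - b)%C.
Proof. exact (im_le_Cmod (a - b)%C). Qed.

Lemma horizontal_lipschitz (y t0 t : R) : Cmod ((t, y) - (t0, y))%C <= Rabs (t - t0).
Proof.
  eapply Rle_trans; [apply Cmod_rect|]. simpl. replace (y + - y) with 0 by ring.
  rewrite Rabs_R0, Rplus_0_r. apply Rle_refl.
Qed.

Lemma vertical_lipschitz (x t0 t : R) : Cmod ((x, t) - (x, t0))%C <= Rabs (t - t0).
Proof.
  eapply Rle_trans; [apply Cmod_rect|]. simpl. replace (x + - x) with 0 by ring.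
  rewrite Rabs_R0, Rplus_0_l. apply Rle_refl.
Qed.

(** The imaginary part of the integral of [G] along the boundary of the
    rectangle; opposite sides are paired in one integrand, which is small
    where [G] is nearly affine. *)
Definition boundary_integral (G : C -> C) (a b c d : R) : R :=
  RInt (fun x => Im (G (x, c)) - Im (G (x, d))) a b +
  RInt (fun y => Re (G (b, y)) - Re (G (a, y))) c d.

Lemma ex_RInt_horizontal (G : C -> C) (a b c d : R) :
  a <= b ->
  (forall x, a <= x <= b -> ccont G (x, c)) -> (forall x, a <= x <= b -> ccont G (x, d)) ->
  ex_RInt (fun x => Im (G (x, c)) - Im (G (x, d))) a b.
Proof.
  intros Hab Hc Hd. apply (ex_RInt_continuous (V := R_CompleteNormedModule)). intros x Hx.
  rewrite Rmin_left, Rmax_right in Hx by auto.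
  apply (continuous_minus (V := R_NormedModule));
    [apply (continuous_along Im G (fun t => (t, c)))|
     apply (continuous_along Im G (fun t => (t, d)))];
    auto using Im_lipschitz, horizontal_lipschitz.
Qed.

Lemma ex_RInt_vertical (G : C -> C) (a b c d : R) :
  c <= d ->
  (forall y, c <= y <= d -> ccont G (a, y)) -> (forall y, c <= y <= d -> ccont G (b, y)) ->
  ex_RInt (fun y => Re (G (b, y)) - Re (G (a, y))) c d.
Proof.
  intros Hcd Ha Hb. apply (ex_RInt_continuous (V := R_CompleteNormedModule)). intros y Hy.
  rewrite Rmin_left, Rmax_right in Hy by auto.
  apply (continuous_minus (V := R_NormedModule));
    [apply (continuous_along Re G (fun t => (b, t)))|
     apply (continuous_along Re G (fun t => (a, t)))];
    auto using Re_lipschitz, vertical_lipschitz.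
Qed.

Lemma boundary_integral_split_x (G : C -> C) (a m b c d : R) :
  a <= m <= b -> c <= d ->
  (forall x y, a <= x <= b -> c <= y <= d -> ccont G (x, y)) ->
  boundary_integral G a b c d = boundary_integral G a m c d + boundary_integral G m b c d.
Proof.
  intros Hm Hcd HG. unfold boundary_integral.
  rewrite <- (RInt_Chasles (V := R_CompleteNormedModule) _ a m b)
    by (apply ex_RInt_horizontal; try lra; intros; apply HG; lra).
  replace (RInt (fun y => Re (G (b, y)) - Re (G (a, y))) c d)
    with (RInt (fun y => Re (G (m, y)) - Re (G (a, y))) c d +
          RInt (fun y => Re (G (b, y)) - Re (G (m, y))) c d).
  - unfold plus; simpl. ring.
  - rewrite <- (RInt_plus (V := R_CompleteNormedModule))
      by (apply ex_RInt_vertical; try lra; intros; apply HG; lra).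
    apply RInt_ext. intros y _. unfold plus; simpl. ring.
Qed.

Lemma boundary_integral_split_y (G : C -> C) (a b c m d : R) :
  a <= b -> c <= m <= d ->
  (forall x y, a <= x <= b -> c <= y <= d -> ccont G (x, y)) ->
  boundary_integral G a b c d = boundary_integral G a b c m + boundary_integral G a b m d.
Proof.
  intros Hab Hm HG. unfold boundary_integral.
  rewrite <- (RInt_Chasles (V := R_CompleteNormedModule) _ c m d)
    by (apply ex_RInt_vertical; try lra; intros; apply HG; lra).
  replace (RInt (fun x => Im (G (x, c)) - Im (G (x, d))) a b)
    with (RInt (fun x => Im (G (x, c)) - Im (G (x, m))) a b +
          RInt (fun x => Im (G (x, m)) - Im (G (x, d))) a b).
  - unfold plus; simpl. ring.
  - rewrite <- (RInt_plus (V := R_CompleteNormedModule))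
      by (apply ex_RInt_horizontal; try lra; intros; apply HG; lra).
    apply RInt_ext. intros y _. unfold plus; simpl. ring.
Qed.

Lemma RInt_near_const (f : R -> R) (a b k e : R) :
  a <= b -> ex_RInt f a b -> (forall t, a <= t <= b -> Rabs (f t - k) <= e) ->
  Rabs (RInt f a b - (b - a) * k) <= (b - a) * e.
Proof.
  intros Hab Hf H.
  replace (RInt f a b - (b - a) * k) with (RInt (fun t => f t - k) a b).
  - apply abs_RInt_le_const; auto.
    apply (ex_RInt_minus (V := R_NormedModule)); auto. apply ex_RInt_const.
  - pose proof (RInt_minus (V := R_CompleteNormedModule) f (fun _ => k) a b Hf (ex_RInt_const _ _ _)) as E.
    unfold minus, plus, opp in E; simpl in E. etransitivity; [exact E|].
    rewrite RInt_const. unfold scal; simpl; unfold mult; simpl. ring.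
Qed.

(** Near a point where [G] is differentiable the boundary integral is small
    compared with the area: the affine part of [G] contributes
    [- (d - c) * Re l] to the first integrand and [(b - a) * Re l] to the
    second, which cancel after integration. *)
Lemma boundary_integral_small (G : C -> C) (z l : C) (eta x y s A B : R) :
  0 < A -> 0 < B -> 0 < s -> 0 <= eta ->
  x <= Re z <= x + s * A -> y <= Im z <= y + s * B ->
  (forall x' y', x <= x' <= x + s * A -> y <= y' <= y + s * B -> ccont G (x', y')) ->
  (forall x' y', x <= x' <= x + s * A -> y <= y' <= y + s * B ->
     Cmod (G (x', y') - G z - l * ((x', y') - z))%C <= eta * Cmod ((x', y') - z)%C) ->
  Rabs (boundary_integral G x (x + s * A) y (y + s * B))
    <= 2 * eta * (A + B) ^ 2 * s ^ 2.
Proof.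
  intros HA HB Hs Heta Hzx Hzy Hcont Hlin.
  assert (HsA : 0 < s * A) by (apply Rmult_lt_0_compat; auto).
  assert (HsB : 0 < s * B) by (apply Rmult_lt_0_compat; auto).
  assert (Herr : forall x' y', x <= x' <= x + s * A -> y <= y' <= y + s * B ->
    Cmod (G (x', y') - G z - l * ((x', y') - z))%C <= eta * (s * (A + B))).
  { intros x' y' Hx Hy. eapply Rle_trans; [apply Hlin; auto|].
    apply Rmult_le_compat_l; auto. destruct z as [p q]; simpl in Hzx, Hzy.
    eapply Rle_trans; [apply Cmod_rect|]. simpl.
    assert (Rabs (x' + - p) <= s * A) by (apply Rabs_le; lra).
    assert (Rabs (y' + - q) <= s * B) by (apply Rabs_le; lra). lra. }
  unfold boundary_integral.
  assert (H1 : Rabs (RInt (fun t => Im (G (t, y)) - Im (G (t, y + s * B))) x (x + s * A)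
     - (x + s * A - x) * (- (s * B) * Re l)) <= (x + s * A - x) * (2 * (eta * (s * (A + B))))).
  { apply RInt_near_const; try lra.
    - apply ex_RInt_horizontal; try lra; intros; apply Hcont; lra.
    - intros t Ht.
      pose proof (Herr t y Ht ltac:(lra)) as E1. pose proof (Herr t (y + s * B) Ht ltac:(lra)) as E2.
      pose proof (im_le_Cmod (G (t, y) - G z - l * ((t, y) - z))%C) as E3.
      pose proof (im_le_Cmod (G (t, (y + s * B)%R) - G z - l * ((t, (y + s * B)%R) - z))%C) as E4.
      set (w1 := G (t, y)) in *. set (w2 := G (t, y + s * B)) in *.
      destruct z as [p q], l as [l1 l2], w1 as [u1 v1], w2 as [u2 v2], (G (p, q)) as [g1 g2].
      simpl in *.
      match type of E3 with Rabs ?e <= _ => match type of E4 with Rabs ?e' <= _ =>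
        replace (v1 - v2 - - (s * B) * l1) with (e - e') by ring;
        pose proof (Rabs_triang e (- e')) as E5; rewrite Rabs_Ropp in E5 end end.
      unfold Rminus at 1. lra. }
  assert (H2 : Rabs (RInt (fun t => Re (G (x + s * A, t)) - Re (G (x, t))) y (y + s * B)
     - (y + s * B - y) * (s * A * Re l)) <= (y + s * B - y) * (2 * (eta * (s * (A + B))))).
  { apply RInt_near_const; try lra.
    - apply ex_RInt_vertical; try lra; intros; apply Hcont; lra.
    - intros t Ht.
      pose proof (Herr x t ltac:(lra) Ht) as E1. pose proof (Herr (x + s * A) t ltac:(lra) Ht) as E2.
      pose proof (re_le_Cmod (G (x, t) - G z - l * ((x, t) - z))%C) as E3.
      pose proof (re_le_Cmod (G ((x + s * A)%R, t) - G z - l * (((x + s * A)%R, t) - z))%C) as E4.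
      set (w1 := G (x, t)) in *. set (w2 := G (x + s * A, t)) in *.
      destruct z as [p q], l as [l1 l2], w1 as [u1 v1], w2 as [u2 v2], (G (p, q)) as [g1 g2].
      simpl in *.
      match type of E3 with Rabs ?e <= _ => match type of E4 with Rabs ?e' <= _ =>
        replace (u2 - u1 - s * A * l1) with (e' - e) by ring;
        pose proof (Rabs_triang e' (- e)) as E5; rewrite Rabs_Ropp in E5 end end.
      unfold Rminus at 1. lra. }
  set (I1 := RInt _ x _) in *. set (I2 := RInt _ y _) in *.
  replace (I1 + I2) with ((I1 - (x + s * A - x) * (- (s * B) * Re l)) +
    (I2 - (y + s * B - y) * (s * A * Re l))) by ring.
  eapply Rle_trans; [apply Rabs_triang|].
  replace (2 * eta * (A + B) ^ 2 * s ^ 2) with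
    ((x + s * A - x) * (2 * (eta * (s * (A + B)))) + (y + s * B - y) * (2 * (eta * (s * (A + B))))) by ring.
  lra.
Qed.

(** Goursat's argument: being small compared with the area near each point and
    additive, the boundary integral is bounded by every positive multiple of
    the area. *)
Lemma goursat_rectangle (G : C -> C) (x0 y0 A B : R) :
  0 < A -> 0 < B ->
  (forall x y, x0 <= x <= x0 + A -> y0 <= y <= y0 + B -> ex_cderive G (x, y)) ->
  boundary_integral G x0 (x0 + A) y0 (y0 + B) = 0.
Proof.
  intros HA HB HG.
  assert (Hc : forall x y, x0 <= x <= x0 + A -> y0 <= y <= y0 + B -> ccont G (x, y))
    by (intros; apply ex_cderive_ccont; auto).
  assert (H : forall eps, 0 < eps -> Rabs (boundary_integral G x0 (x0 + A) y0 (y0 + B)) <= eps).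
  { intros eps He.
    pose proof (rect_induction A B (fun x y s => x0 <= x -> x + s * A <= x0 + A -> y0 <= y ->
      y + s * B <= y0 + B -> Rabs (boundary_integral G x (x + s * A) y (y + s * B)) <= eps * s ^ 2)
      x0 y0 1) as Hind.
    simpl in Hind. rewrite !Rmult_1_l, !Rmult_1_r in Hind. apply Hind; try lra; clear Hind.
    - intros x y s Hs H1 H2 H3 H4 Hx1 Hx2 Hy1 Hy2.
      assert (HsA : 0 < s * A) by (apply Rmult_lt_0_compat; auto).
      assert (HsB : 0 < s * B) by (apply Rmult_lt_0_compat; auto).
      replace (x + s / 2 * A + s / 2 * A) with (x + s * A) in * by field.
      replace (y + s / 2 * B + s / 2 * B) with (y + s * B) in * by field.
      specialize (H1 ltac:(lra) ltac:(lra) ltac:(lra) ltac:(lra)).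
      specialize (H2 ltac:(lra) ltac:(lra) ltac:(lra) ltac:(lra)).
      specialize (H3 ltac:(lra) ltac:(lra) ltac:(lra) ltac:(lra)).
      specialize (H4 ltac:(lra) ltac:(lra) ltac:(lra) ltac:(lra)).
      rewrite (boundary_integral_split_x G x (x + s / 2 * A)) by (try lra; intros; apply Hc; lra).
      rewrite (boundary_integral_split_y G x (x + s / 2 * A) y (y + s / 2 * B))
        by (try lra; intros; apply Hc; lra).
      rewrite (boundary_integral_split_y G (x + s / 2 * A) (x + s * A) y (y + s / 2 * B))
        by (try lra; intros; apply Hc; lra).
      eapply Rle_trans; [apply Rabs_triang|].
      eapply Rle_trans; [apply Rplus_le_compat; apply Rabs_triang|]. lra.
    - intros p q Hp Hq. destruct (HG p q Hp Hq) as [l Hl].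
      assert (HAB : 0 < 2 * (A + B) ^ 2) by (apply Rmult_lt_0_compat; [lra|apply pow_lt; lra]).
      assert (Heta : 0 < eps / (2 * (A + B) ^ 2)) by (apply Rdiv_lt_0_compat; auto).
      destruct (proj1 (is_cderive_eps _ _ _) Hl _ Heta) as [d [Hd H]].
      exists (d / (A + B)). split; [apply Rdiv_lt_0_compat; lra|].
      intros x y s [Hs Hsd] Hx1 Hx2 Hy1 Hy2 Hpx Hqy _ _ _ _.
      eapply Rle_trans; [apply (boundary_integral_small G (p, q) l (eps / (2 * (A + B) ^ 2)))|];
        auto; try lra.
      + intros x' y' Hx' Hy'; apply Hc; lra.
      + intros x' y' Hx' Hy'. apply H. eapply Rle_lt_trans; [apply Cmod_rect|]. simpl.
        assert (Rabs (x' + - p) <= s * A) by (apply Rabs_le; lra).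
        assert (Rabs (y' + - q) <= s * B) by (apply Rabs_le; lra).
        apply (Rmult_lt_compat_r (A + B)) in Hsd; [|lra].
        replace (d / (A + B) * (A + B)) with d in Hsd by (field; lra). lra.
      + right. field. lra. }
  destruct (Req_dec (boundary_integral G x0 (x0 + A) y0 (y0 + B)) 0) as [|Hne]; auto.
  apply Rabs_pos_lt in Hne. specialize (H _ (Rmult_lt_0_compat _ _ Hne (Rinv_0_lt_compat 2 Rlt_0_2))). lra.
Qed.


(** * The complex exponential and logarithm *)

Lemma Cexp_plus (z w : C) : Cexp (z + w)%C = (Cexp z * Cexp w)%C.
Proof.
  destruct z as [a b], w as [c d]. unfold Cexp, Cmult; simpl.
  rewrite exp_plus, cos_plus, sin_plus. f_equal; ring.
Qed.

Lemma Cexp_0 : Cexp (RtoC 0) = RtoC 1.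
Proof. unfold Cexp; simpl. rewrite exp_0, cos_0, sin_0. apply injective_projections; simpl; ring. Qed.

Lemma Cmod_Cexp (z : C) : Cmod (Cexp z) = exp (Re z).
Proof.
  rewrite <- (Rabs_pos_eq (Cmod (Cexp z))) by apply Cmod_ge_0.
  rewrite <- (Rabs_pos_eq (exp (Re z))) by (apply Rlt_le, exp_pos).
  apply Rsqr_eq_abs_0. rewrite !Rsqr_pow2, Cmod_sqr. unfold Cexp; simpl.
  pose proof (sin2_cos2 (Im z)) as H. unfold Rsqr in H.
  replace (exp (Re z) * (exp (Re z) * 1)) with
    (exp (Re z) * exp (Re z) * (sin (Im z) * sin (Im z) + cos (Im z) * cos (Im z)))
    by (rewrite H; ring). ring.
Qed.

Lemma Cexp_neq_0 (z : C) : Cexp z <> RtoC 0.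
Proof. apply Cmod_gt_0. rewrite Cmod_Cexp. apply exp_pos. Qed.

Lemma Cexp_minus (z w : C) : Cexp (z - w)%C = (Cexp z / Cexp w)%C.
Proof.
  assert (H : (Cexp (z - w) * Cexp w)%C = Cexp z)
    by (rewrite <- Cexp_plus; f_equal; ring).
  rewrite <- H. field. apply Cexp_neq_0.
Qed.

Lemma derivable_pt_lim_0_error (f : R -> R) (l eta : R) :
  derivable_pt_lim f 0 l -> 0 < eta ->
  exists del, 0 < del /\ forall h, Rabs h < del -> Rabs (f h - f 0 - l * h) <= eta * Rabs h.
Proof.
  intros Hf He. destruct (Hf eta He) as [d H]. exists d; split; [apply cond_pos|].
  intros h Hh. destruct (Req_dec h 0) as [->|Hne].
  - replace (f 0 - f 0 - l * 0) with 0 by ring. rewrite Rabs_R0. lra.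
  - specialize (H h Hne Hh). rewrite Rplus_0_l in H.
    replace (f h - f 0 - l * h) with (((f h - f 0) / h - l) * h) by (field; auto).
    rewrite Rabs_mult. apply Rmult_le_compat_r; [apply Rabs_pos|lra].
Qed.

Lemma is_cderive_Cexp_0 : is_cderive Cexp (RtoC 0) (RtoC 1).
Proof.
  apply is_cderive_eps. intros eps He. set (eta := Rmin (eps / 6) (1 / 2)).
  assert (Heta : 0 < eta) by (apply Rmin_pos; lra).
  assert (Heta1 : eta <= eps / 6) by apply Rmin_l.
  assert (Heta2 : eta <= 1 / 2) by apply Rmin_r.
  destruct (derivable_pt_lim_0_error exp 1 eta) as [d1 [Hd1 H1]]; auto.
  { pose proof (derivable_pt_lim_exp 0) as He0. rewrite exp_0 in He0. exact He0. }
  destruct (derivable_pt_lim_0_error cos (- sin 0) eta) as [d2 [Hd2 H2]]; auto.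
  { apply derivable_pt_lim_cos. }
  destruct (derivable_pt_lim_0_error sin (cos 0) eta) as [d3 [Hd3 H3]]; auto.
  { apply derivable_pt_lim_sin. }
  exists (Rmin (Rmin d1 (eta / 2)) (Rmin d2 d3)). split; [repeat apply Rmin_pos; lra|].
  intros [x y] Hw.
  replace ((x, y) - RtoC 0)%C with (x, y) in * by (apply injective_projections; simpl; ring).
  pose proof (Rmin_l (Rmin d1 (eta / 2)) (Rmin d2 d3)). pose proof (Rmin_r (Rmin d1 (eta / 2)) (Rmin d2 d3)).
  pose proof (Rmin_l d1 (eta / 2)). pose proof (Rmin_r d1 (eta / 2)).
  pose proof (Rmin_l d2 d3). pose proof (Rmin_r d2 d3).
  pose proof (re_le_Cmod (x, y)) as Hx. pose proof (im_le_Cmod (x, y)) as Hy. simpl in Hx, Hy.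
  specialize (H1 x ltac:(lra)). specialize (H2 y ltac:(lra)). specialize (H3 y ltac:(lra)).
  rewrite exp_0 in H1. rewrite sin_0, cos_0 in H2. rewrite sin_0, cos_0 in H3.
  rewrite Cexp_0.
  replace (Cexp (x, y) - RtoC 1 - RtoC 1 * (x, y))%C with
    ((exp x - 1 - 1 * x) + exp x * (cos y - 1 - - 0 * y),
     exp x * (sin y - 0 - 1 * y) + (exp x - 1) * y)
    by (unfold Cexp; apply injective_projections; simpl; ring).
  eapply Rle_trans; [apply Cmod_rect|].
  assert (Hx1 : Rabs (exp x - 1) <= eta).
  { replace (exp x - 1) with ((exp x - 1 - 1 * x) + x) by ring.
    eapply Rle_trans; [apply Rabs_triang|]. nra. }
  assert (Hx2 : 0 < exp x <= 2).
  { split; [apply exp_pos|]. apply Rabs_le_between in Hx1. lra. }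
  pose proof (Rabs_pos x). pose proof (Rabs_pos y).
  assert (T1 : Rabs ((exp x - 1 - 1 * x) + exp x * (cos y - 1 - - 0 * y))
    <= eta * Rabs x + 2 * (eta * Rabs y)).
  { eapply Rle_trans; [apply Rabs_triang|]. apply Rplus_le_compat; auto.
    rewrite Rabs_mult, (Rabs_pos_eq (exp x)) by lra.
    apply Rmult_le_compat; try lra. apply Rabs_pos. }
  assert (T2 : Rabs (exp x * (sin y - 0 - 1 * y) + (exp x - 1) * y)
    <= 2 * (eta * Rabs y) + eta * Rabs y).
  { eapply Rle_trans; [apply Rabs_triang|]. rewrite !Rabs_mult, (Rabs_pos_eq (exp x)) by lra.
    apply Rplus_le_compat; apply Rmult_le_compat; try lra; apply Rabs_pos. }
  nra.
Qed.

Lemma is_cderive_Cexp (z : C) : is_cderive Cexp z (Cexp z).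
Proof.
  assert (H : is_cderive (fun w => Cexp z * Cexp (w - z))%C z (Cexp z * (RtoC 1 * (RtoC 1 - RtoC 0)))%C).
  { apply is_cderive_scal. apply (is_cderive_comp Cexp (fun w => w - z)%C).
    - replace (z - z)%C with (RtoC 0) by ring. apply is_cderive_Cexp_0.
    - apply is_cderive_minus; [apply is_cderive_id|apply is_cderive_const]. }
  replace (Cexp z * (RtoC 1 * (RtoC 1 - RtoC 0)))%C with (Cexp z) in H by ring.
  eapply (is_cderive_ext_near _ _ _ _ 1 Rlt_0_1); [|exact H].
  intros w _. cbv beta. rewrite <- Cexp_plus. f_equal; ring.
Qed.

Definition rcont (L : C -> R) (z : C) : Prop :=
  continuous (T := AbsRing_UniformSpace C_AbsRing) (U := R_UniformSpace) L z.

Lemma rcont_lipschitz (L : C -> R) (z : C) :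
  (forall a b, Rabs (L a - L b) <= Cmod (a - b)%C) -> rcont L z.
Proof.
  intros HL P [e He]. apply locally_Cmod. exists e; split; [apply cond_pos|].
  intros w Hw. apply He. eapply Rle_lt_trans; [apply HL|exact Hw].
Qed.

Lemma rcont_eps (L : C -> R) (z : C) (eps : R) : rcont L z -> 0 < eps ->
  exists del, 0 < del /\ forall w, Cmod (w - z)%C < del -> Rabs (L w - L z) < eps.
Proof.
  intros H He. apply (locally_Cmod z (fun w => Rabs (L w - L z) < eps)).
  apply (H (fun r => Rabs (r - L z) < eps)). exists (mkposreal eps He). intros r Hr. exact Hr.
Qed.

Lemma Cmod_lipschitz (a b : C) : Rabs (Cmod a - Cmod b) <= Cmod (a - b)%C.
Proof.
  pose proof (Cmod_minus_ge a b). pose proof (Cmod_minus_ge b a) as H2.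
  rewrite Cmod_minus_sym in H2. apply Rabs_le; lra.
Qed.

Lemma rcont_comp (g : R -> R) (L : C -> R) (z : C) :
  rcont L z -> continuous g (L z) -> rcont (fun w => g (L w)) z.
Proof. intros HL Hg. exact (continuous_comp (U := AbsRing_UniformSpace C_AbsRing) L g z HL Hg). Qed.

Lemma Re_pos_neq_0 (w : C) : 0 < Re w -> w <> RtoC 0.
Proof. intros H E; rewrite E in H; simpl in H; lra. Qed.

Lemma ccont_Clog (w : C) : 0 < Re w -> ccont Clog w.
Proof.
  intros Hw eps He.
  assert (Hm : 0 < Cmod w) by (apply Cmod_gt_0, Re_pos_neq_0; auto).
  destruct (rcont_eps (fun u => ln (Cmod u)) w (eps / 2)) as [d1 [Hd1 H1]]; [|lra|].
  { apply (rcont_comp ln Cmod); [apply rcont_lipschitz, Cmod_lipschitz|].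
    apply (ex_derive_continuous (V := R_NormedModule)). exists (/ Cmod w). apply is_derive_ln; auto. }
  destruct (rcont_eps (fun u => atan (Im u / Re u)) w (eps / 2)) as [d2 [Hd2 H2]]; [|lra|].
  { apply (rcont_comp atan (fun u => Im u / Re u)).
    - unfold Rdiv. apply (continuous_mult (U := AbsRing_UniformSpace C_AbsRing) (K := R_AbsRing) Im (fun u => / Re u)).
      + apply rcont_lipschitz, Im_lipschitz.
      + apply (rcont_comp Rinv Re); [apply rcont_lipschitz, Re_lipschitz|].
        apply (ex_derive_continuous (V := R_NormedModule)). auto_derive. lra.
    - apply continuity_pt_filterlim, derivable_continuous_pt, derivable_pt_atan. }
  exists (Rmin d1 d2); split; [apply Rmin_pos; auto|]. intros u Hu.
  pose proof (Rmin_l d1 d2). pose proof (Rmin_r d1 d2).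
  specialize (H1 u ltac:(lra)). specialize (H2 u ltac:(lra)).
  eapply Rle_lt_trans; [apply (Cmod_rect (ln (Cmod u) - ln (Cmod w))
    (atan (Im u / Re u) - atan (Im w / Re w)))|]. lra.
Qed.

Lemma is_cderive_Clog (w : C) : 0 < Re w -> is_cderive Clog w (/ w)%C.
Proof.
  intros Hw. assert (Hne : w <> RtoC 0) by (apply Re_pos_neq_0; auto).
  replace (/ w)%C with (RtoC 1 / w)%C by (field; auto).
  apply (is_cderive_lift Cexp Clog (fun u => u) w w (RtoC 1) (Re w)); auto.
  - intros u Hu. apply Cexp_Clog. pose proof (Re_lipschitz w u) as H.
    rewrite Cmod_minus_sym in H. apply Rabs_le_between in H. lra.
  - apply ccont_Clog; auto.
  - rewrite <- (Cexp_Clog w) at 2 by auto. apply is_cderive_Cexp.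
  - apply is_cderive_id.
Qed.

Lemma Clog_1 : Clog (RtoC 1) = RtoC 0.
Proof.
  unfold Clog. rewrite Cmod_1, ln_1. simpl. unfold Rdiv. rewrite Rmult_0_l, atan_0. reflexivity.
Qed.

(** The bound on [Im z] leaves only one multiple of [2 PI]. *)
Lemma Cexp_eq_1 (z : C) : Cexp z = RtoC 1 -> Rabs (Im z) < 2 * PI -> z = RtoC 0.
Proof.
  intros H Hy. assert (Hre : Re z = 0).
  { assert (E : Cmod (Cexp z) = 1) by (rewrite H; apply Cmod_1).
    rewrite Cmod_Cexp in E. rewrite <- exp_0 in E. apply exp_inv in E; auto. }
  assert (Hcos : cos (Im z) = 1).
  { apply (f_equal fst) in H. unfold Cexp in H. simpl in H. rewrite Hre, exp_0 in H. lra. }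
  assert (Hsin : sin (Im z / 2) = 0).
  { replace (Im z) with (2 * (Im z / 2)) in Hcos by field.
    rewrite cos_2a_sin in Hcos. nra. }
  assert (Him : Im z = 0).
  { apply Rabs_def2 in Hy. destruct (Rtotal_order (Im z) 0) as [Hlt|[->|Hgt]]; auto.
    - pose proof (sin_gt_0 (- (Im z / 2)) ltac:(lra) ltac:(lra)) as Hs. rewrite sin_neg in Hs. lra.
    - pose proof (sin_gt_0 (Im z / 2) ltac:(lra) ltac:(lra)). lra. }
  destruct z as [x y]; simpl in *; subst; reflexivity.
Qed.

(** * Mean values, the maximum principle and Schwarz's lemma *)

(** Goursat's theorem for [F (z0 + r * Cexp zeta)] on a long rectangle of
    height [2 PI]: by periodicity the horizontal sides cancel, so the mean of
    [F] over a circle does not depend on the radius, and tends to [F z0] as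
    the radius shrinks.  In these coordinates the centre is never met, so
    continuity there is enough. *)
Lemma circle_mean (F : C -> C) (z0 : C) (r eta : R) :
  0 < r -> 0 < eta ->
  (forall z, 0 < Cmod (z - z0)%C <= r -> ex_cderive F z) -> ccont F z0 ->
  ~ (forall z, Cmod (z - z0)%C = r -> Re (F z) <= Re (F z0) - eta).
Proof.
  intros Hr Heta HF Hc Hle.
  destruct (Hc (eta / 2)) as [d [Hd Hnear]]; [lra|].
  set (arg := fun zeta => (z0 + RtoC r * Cexp zeta)%C).
  assert (Harg : forall x y, Cmod (arg (x, y) - z0)%C = r * exp x).
  { intros x y. unfold arg.
    replace (z0 + RtoC r * Cexp (x, y) - z0)%C with (RtoC r * Cexp (x, y))%C by ring.
    rewrite Cmod_mult, Cmod_R, Cmod_Cexp, Rabs_pos_eq by lra. reflexivity. }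
  set (A := Rmax 1 (1 - ln (d / r))).
  assert (HA : 0 < A) by (unfold A; pose proof (Rmax_l 1 (1 - ln (d / r))); lra).
  assert (HAd : r * exp (- A) < d).
  { assert (HA2 : - A < ln (d / r)) by (unfold A; pose proof (Rmax_r 1 (1 - ln (d / r))); lra).
    apply exp_increasing in HA2. rewrite exp_ln in HA2 by (apply Rdiv_lt_0_compat; auto).
    apply (Rmult_lt_compat_l r) in HA2; auto. replace (r * (d / r)) with d in HA2 by (field; lra). exact HA2. }
  pose proof PI_RGT_0 as HPI.
  set (G := fun zeta => F (arg zeta)).
  assert (HG : forall x y, x <= 0 -> ex_cderive G (x, y)).
  { intros x y Hx. destruct (HF (arg (x, y))) as [l Hl].
    - rewrite Harg. pose proof (exp_pos x). split; [apply Rmult_lt_0_compat; auto|].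
      assert (exp x <= 1). { rewrite <- exp_0. destruct Hx as [Hx| ->]; [apply Rlt_le, exp_increasing; auto|lra]. }
      nra.
    - exists (l * (RtoC 0 + RtoC r * Cexp (x, y)))%C. apply (is_cderive_comp F arg); auto.
      apply is_cderive_plus; [apply is_cderive_const|]. apply is_cderive_scal, is_cderive_Cexp. }
  pose proof (goursat_rectangle G (- A) 0 A (2 * PI) HA ltac:(lra)) as Hgours.
  replace (- A + A) with 0 in Hgours by ring. rewrite Rplus_0_l in Hgours.
  specialize (Hgours ltac:(intros; apply HG; lra)). unfold boundary_integral in Hgours.
  assert (Hper : RInt (fun x => Im (G (x, 0)) - Im (G (x, 2 * PI))) (- A) 0 = 0).
  { rewrite (RInt_ext _ (fun _ => 0)).
    - rewrite RInt_const. unfold scal; simpl; unfold mult; simpl. ring.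
    - intros x _. unfold G, arg, Cexp. simpl. rewrite cos_2PI, sin_2PI, cos_0, sin_0. ring. }
  rewrite Hper, Rplus_0_l in Hgours.
  assert (HI : RInt (fun y => Re (G (0, y)) - Re (G (- A, y))) 0 (2 * PI)
    <= RInt (fun _ => - (eta / 2)) 0 (2 * PI)).
  { apply RInt_le; [lra| | apply ex_RInt_const|].
    - apply ex_RInt_vertical; [lra| |]; intros; apply ex_cderive_ccont, HG; lra.
    - intros y _. unfold G.
      assert (H1 : Re (F (arg (0, y))) <= Re (F z0) - eta)
        by (apply Hle; rewrite Harg, exp_0; ring).
      assert (H2 : Cmod (F (arg ((- A)%R, y)) - F z0)%C < eta / 2)
        by (apply Hnear; rewrite Harg; auto).
      pose proof (Re_lipschitz (F (arg (- A, y))) (F z0)) as H3.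
      apply Rabs_le_between in H3. lra. }
  rewrite RInt_const in HI. unfold scal in HI; simpl in HI; unfold mult in HI; simpl in HI. nra.
Qed.

(** At an interior maximum [z1] of [Re F + eps * |z| ^ 2], the function
    [F + 2 * eps * Cconj z1 * z] would violate the mean value property. *)
Lemma max_principle_Re (F : C -> C) (r M : R) :
  0 < r ->
  (forall z, 0 < Cmod z <= r -> ex_cderive F z) -> ccont F (RtoC 0) ->
  (forall z, Cmod z = r -> Re (F z) <= M) ->
  forall z, Cmod z <= r -> Re (F z) <= M.
Proof.
  intros Hr HF Hc HM z Hz.
  assert (Hcont : forall w, Cmod w <= r -> ccont F w).
  { intros w Hw. destruct (Rle_lt_dec (Cmod w) 0) as [H0|H0].
    - assert (w = RtoC 0) as -> by (apply Cmod_eq_0; pose proof (Cmod_ge_0 w); lra). auto.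
    - apply ex_cderive_ccont, HF; lra. }
  apply le_epsilon. intros e He.
  set (eps := e / (r ^ 2)).
  assert (Hr2 : 0 < r ^ 2) by (apply pow_lt; auto).
  assert (Heps : 0 < eps) by (apply Rdiv_lt_0_compat; auto).
  assert (Epsr : eps * r ^ 2 = e) by (unfold eps; field; lra). clearbody eps.
  destruct (disk_max (fun w => Re (F w) + eps * Cmod w ^ 2) r Hr) as [z1 [Hz1 Hmax]].
  { intros w Hw e' He'. destruct (Hcont w Hw (e' / 2)) as [d [Hd H]]; [lra|].
    assert (Hq : 0 < e' / (2 * eps * (2 * r))) by (apply Rdiv_lt_0_compat; [lra|repeat apply Rmult_lt_0_compat; lra]).
    exists (Rmin d (e' / (2 * eps * (2 * r)))). split; [apply Rmin_pos; auto|].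
    intros v Hv Hvw. pose proof (Rmin_l d (e' / (2 * eps * (2 * r)))).
    pose proof (Rmin_r d (e' / (2 * eps * (2 * r)))).
    specialize (H v ltac:(lra)). pose proof (Re_lipschitz (F v) (F w)) as H3.
    apply Rabs_le_between in H3.
    pose proof (Cmod_lipschitz v w) as H4. apply Rabs_le_between in H4.
    pose proof (Cmod_ge_0 v). pose proof (Cmod_ge_0 w).
    assert (H8 : Cmod (v - w)%C < e' / (2 * eps * (2 * r))) by lra.
    assert (H6 : eps * (Cmod v ^ 2 - Cmod w ^ 2) <= eps * (2 * r) * Cmod (v - w)%C).
    { rewrite Rmult_assoc. apply Rmult_le_compat_l; [lra|].
      destruct (Rle_dec (Cmod v) (Cmod w)); [|nra].
      pose proof (Cmod_ge_0 (v - w)%C). nra. }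
    assert (H7 : eps * (2 * r) * Cmod (v - w)%C <= e' / 2).
    { apply Rle_trans with (eps * (2 * r) * (e' / (2 * eps * (2 * r)))).
      - apply Rmult_le_compat_l; [|lra]. apply Rmult_le_pos; lra.
      - right. field. split; lra. }
    lra. }
  destruct (Rle_lt_or_eq_dec _ _ Hz1) as [Hin|Hon].
  - exfalso.
    assert (Hdel : exists del, 0 < del /\ del <= r - Cmod z1 /\ (z1 <> RtoC 0 -> del < Cmod z1)).
    { destruct (Rle_lt_dec (Cmod z1) 0) as [H0|H0].
      - exists (r - Cmod z1). split; [lra|split; [lra|]]. intro Hne. apply Cmod_gt_0 in Hne. lra.
      - exists (Rmin (r - Cmod z1) (Cmod z1 / 2)).
        pose proof (Rmin_l (r - Cmod z1) (Cmod z1 / 2)). pose proof (Rmin_r (r - Cmod z1) (Cmod z1 / 2)).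
        split; [apply Rmin_pos; lra|]. split; lra. }
    destruct Hdel as [del [Hd1 [Hd2 Hd3]]].
    apply (circle_mean (fun w => F w + RtoC (2 * eps) * Cconj z1 * w)%C z1 del (eps * del ^ 2)); auto.
    + apply Rmult_lt_0_compat; auto. apply pow_lt; auto.
    + intros w Hw. destruct (HF w) as [l Hl].
      { split.
        - destruct (Rle_lt_dec (Cmod w) 0) as [H0|H0]; auto. exfalso.
          assert (w = RtoC 0) as -> by (apply Cmod_eq_0; pose proof (Cmod_ge_0 w); lra).
          replace (RtoC 0 - z1)%C with (- z1)%C in Hw by ring. rewrite Cmod_opp in Hw.
          assert (z1 <> RtoC 0) by (apply Cmod_gt_0; lra). specialize (Hd3 H). lra.
        - pose proof (Cmod_minus_ge w z1). lra. }
      exists (l + RtoC (2 * eps) * Cconj z1 * RtoC 1)%C. apply is_cderive_plus; auto.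
      apply (is_cderive_scal (RtoC (2 * eps) * Cconj z1)%C (fun w => w)), is_cderive_id.
    + assert (Hlin : ccont (fun w => RtoC (2 * eps) * Cconj z1 * w)%C z1).
      { eapply is_cderive_ccont.
        apply (is_cderive_scal (RtoC (2 * eps) * Cconj z1)%C (fun w => w)), is_cderive_id. }
      intros e' He'. destruct (Hcont z1 Hz1 (e' / 2)) as [da [Hda Ha]]; [lra|].
      destruct (Hlin (e' / 2)) as [db [Hdb Hb]]; [lra|].
      exists (Rmin da db); split; [apply Rmin_pos; auto|]. intros w Hw.
      pose proof (Rmin_l da db). pose proof (Rmin_r da db).
      specialize (Ha w ltac:(lra)). specialize (Hb w ltac:(lra)).
      set (c := (RtoC (2 * eps) * Cconj z1)%C) in *.
      replace (F w + c * w - (F z1 + c * z1))%C with ((F w - F z1) + (c * w - c * z1))%C by ring.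
      eapply Rle_lt_trans; [apply Cmod_triangle|]. lra.
    + intros w Hw.
      assert (Hwr : Cmod w <= r) by (pose proof (Cmod_minus_ge w z1); lra).
      specialize (Hmax w Hwr). simpl in Hmax. rewrite <- Hw.
      change (Cmod w * (Cmod w * 1)) with (Cmod w ^ 2) in Hmax.
      change (Cmod z1 * (Cmod z1 * 1)) with (Cmod z1 ^ 2) in Hmax.
      rewrite Cmod_sqr in Hmax |- *. rewrite Cmod_sqr in Hmax.
      destruct w as [a b], z1 as [p q], (F (a, b)) as [u v], (F (p, q)) as [u' v'].
      simpl in *. nra.
  - specialize (Hmax z Hz). simpl in Hmax. specialize (HM z1 Hon). rewrite Hon in Hmax.
    simpl in Epsr.
    assert (0 <= eps * (Cmod z * (Cmod z * 1))).
    { apply Rmult_le_pos; [lra|]. rewrite Rmult_1_r. apply Rmult_le_pos; apply Cmod_ge_0. }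
    lra.
Qed.

(** The maximum principle for [S z / z], extended to the origin by the
    derivative of [S]; the extension is continuous there, which is what
    [max_principle_Re] asks for at the centre. *)
Lemma schwarz_lemma (S : C -> C) (R0 : R) :
  0 < R0 -> (forall z, Cmod z < R0 -> ex_cderive S z) -> S (RtoC 0) = RtoC 0 ->
  (forall z, Cmod z < R0 -> Cmod (S z) <= 1) ->
  forall z, Cmod z < R0 -> R0 * Cmod (S z) <= Cmod z.
Proof.
  intros HR HS H0 H1 z Hz.
  destruct (Rle_lt_dec (Cmod z) 0) as [Hz0|Hz0].
  { assert (z = RtoC 0) as -> by (apply Cmod_eq_0; pose proof (Cmod_ge_0 z); lra).
    rewrite H0, Cmod_0. lra. }
  assert (Hzne : z <> RtoC 0) by (apply Cmod_gt_0; auto).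
  destruct (HS (RtoC 0)) as [s0 Hs0]; [rewrite Cmod_0; auto|].
  set (Q := fun w => if excluded_middle_informative (w = RtoC 0) then s0 else (S w / w)%C).
  assert (HQ : forall w, w <> RtoC 0 -> Q w = (S w / w)%C).
  { intros w Hw. unfold Q. destruct excluded_middle_informative; [contradiction|auto]. }
  assert (HQ0 : Q (RtoC 0) = s0).
  { unfold Q. destruct excluded_middle_informative; [auto|congruence]. }
  (* With this constant, Re (c * Q) is |Q z| ^ 2 at z and at most
     |Q z| * |Q| elsewhere. *)
  set (c := Cconj (Q z)).
  assert (Hmain : forall r, Cmod z <= r < R0 -> r * Cmod (S z) <= Cmod z).
  { intros r [Hzr HrR].
    assert (Hre : Re (c * Q z)%C <= Cmod c * / r).
    { apply (max_principle_Re (fun w => c * Q w)%C r); auto; try lra.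
      - intros w Hw. assert (Hwne : w <> RtoC 0) by (apply Cmod_gt_0; lra).
        destruct (HS w) as [l Hl]; [lra|].
        eexists. eapply (is_cderive_ext_near (fun v => c * (S v / v))%C _ _ _ (Cmod w)); [lra| |].
        + intros v Hv. rewrite HQ; auto. intros ->.
          replace (RtoC 0 - w)%C with (- w)%C in Hv by ring. rewrite Cmod_opp in Hv. lra.
        + apply is_cderive_scal. apply is_cderive_div; [exact Hl|apply is_cderive_id|auto].
      - intros e He.
        assert (Hq : 0 < e / (Cmod c + 1) / 2).
        { pose proof (Cmod_ge_0 c). assert (0 < e / (Cmod c + 1)) by (apply Rdiv_lt_0_compat; lra). lra. }
        destruct (proj1 (is_cderive_eps _ _ _) Hs0 _ Hq) as [d [Hd H]].
        exists d; split; auto. intros w Hw.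
        replace (c * Q w - c * Q (RtoC 0))%C with (c * (Q w - s0))%C by (rewrite HQ0; ring).
        rewrite Cmod_mult. pose proof (Cmod_ge_0 c) as Hc0.
        assert (Hb : Cmod (Q w - s0)%C <= e / (Cmod c + 1) / 2).
        { destruct (excluded_middle_informative (w = RtoC 0)) as [->|Hne].
          - rewrite HQ0. replace (s0 - s0)%C with (RtoC 0) by ring. rewrite Cmod_0. lra.
          - rewrite HQ by auto. specialize (H w Hw). rewrite H0 in H.
            replace (w - RtoC 0)%C with w in H by ring.
            replace (S w / w - s0)%C with ((S w - RtoC 0 - s0 * w) / w)%C by (field; auto).
            rewrite Cmod_div by auto. apply Rdiv_le_iff; auto. apply Cmod_gt_0; auto. }
        apply Rle_lt_trans with (Cmod c * (e / (Cmod c + 1) / 2)).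
        + apply Rmult_le_compat_l; auto.
        + replace (Cmod c * (e / (Cmod c + 1) / 2)) with (Cmod c / (Cmod c + 1) * (e / 2))
            by (field; lra).
          assert (Cmod c / (Cmod c + 1) < 1) by (apply Rdiv_lt_iff; lra). nra.
      - intros w Hw. assert (Hwne : w <> RtoC 0) by (apply Cmod_gt_0; lra).
        eapply Rle_trans; [apply Rle_abs|]. eapply Rle_trans; [apply re_le_Cmod|].
        rewrite Cmod_mult. apply Rmult_le_compat_l; [apply Cmod_ge_0|].
        rewrite HQ, Cmod_div, Hw by auto. apply Rdiv_le_iff; [lra|].
        rewrite Rinv_l by lra. apply H1. lra. }
    assert (Hc2 : Re (c * Q z)%C = Cmod (Q z) ^ 2).
    { unfold c. rewrite Cmod_sqr. destruct (Q z) as [a b]. simpl. ring. }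
    assert (Hcm : Cmod c = Cmod (Q z)) by apply Cmod_conj.
    rewrite Hc2, Hcm in Hre.
    assert (HSz : Cmod (S z) = Cmod (Q z) * Cmod z).
    { rewrite <- Cmod_mult, HQ by auto. f_equal. field; auto. }
    rewrite HSz. pose proof (Cmod_ge_0 (Q z)) as HQp.
    assert (Hfin : r * Cmod (Q z) <= 1).
    { destruct HQp as [HQp|HQp]; [|rewrite <- HQp; lra].
      assert (Cmod (Q z) <= / r) by (apply Rmult_le_reg_l with (Cmod (Q z)); nra).
      apply Rmult_le_reg_l with (/ r); [apply Rinv_0_lt_compat; lra|].
      rewrite <- Rmult_assoc, Rinv_l by lra. lra. }
    nra. }
  apply Rnot_lt_le. intros Hlt.
  (* The bound for all radii below R0 passes to R0: take a radius half-way
     between the critical one and R0. *)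
  assert (Hsz : 0 < Cmod (S z)).
  { destruct (Cmod_ge_0 (S z)) as [|E]; auto. rewrite <- E in Hlt. lra. }
  set (r := Rmax (Cmod z) ((Cmod z / Cmod (S z) + R0) / 2)).
  assert (Hq : Cmod z / Cmod (S z) < R0) by (apply Rdiv_lt_iff; auto).
  assert (Hr : Cmod z <= r < R0).
  { unfold r. split; [apply Rmax_l|]. apply Rmax_lub_lt; lra. }
  specialize (Hmain r Hr).
  assert (Hr2 : Cmod z / Cmod (S z) < r).
  { unfold r. eapply Rlt_le_trans; [|apply Rmax_r]. lra. }
  apply Rdiv_lt_iff in Hr2; auto. lra.
Qed.


(** * The Schwarz-type bound for spirallike functions *)

Lemma holomorphic_derive (f : C -> C) (z : C) :
  holomorphic_disk f -> in_disk z -> is_cderive f z (C_derive f z).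
Proof. intros Hf Hz. apply C_derive_correct; [exact z|exact (Hf z Hz)]. Qed.

(** [z] times the logarithmic derivative of [f ^ (1 / mu) / (1 - z)], whose
    square is [h / z] for the starlike function
    [h = z * f ^ (2 / mu) / (1 - z) ^ 2] of order [beta] attached to [f]. *)
Definition logder (mu : C) (f : C -> C) (z : C) : C :=
  (z * C_derive f z / (mu * f z) + z / (RtoC 1 - z))%C.

Lemma classG_logder (mu : C) (beta : R) (f : C -> C) (z : C) :
  mu <> RtoC 0 -> classG mu beta f -> in_disk z ->
  - (1 - beta) / 2 < Re (logder mu f z).
Proof.
  intros Hmu [_ [_ [Hne Hre]]] Hz. specialize (Hre z Hz). specialize (Hne z Hz).
  pose proof (one_minus_disk_neq0 z Hz) as H1.
  replace (RtoC 2 / mu * (z * C_derive f z / f z) + (RtoC 1 + z) / (RtoC 1 - z))%C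
    with (RtoC 2 * logder mu f z + RtoC 1)%C in Hre
    by (unfold logder; field; auto).
  rewrite re_plus, re_scal_l, re_RtoC in Hre. lra.
Qed.

Lemma vertical_derive (K : C -> C) (x t : R) (l : C) :
  is_cderive K (x, t) l -> is_derive (fun s => Im (K (x, s))) t (Re l).
Proof.
  intros H. apply is_derive_Reals. intros eps He.
  destruct (proj1 (is_cderive_eps _ _ _) H (eps / 2)) as [d [Hd Hd']]; [lra|].
  exists (mkposreal d Hd). intros h Hh Hlt. simpl in Hlt.
  assert (E : ((x, (t + h)%R) - (x, t))%C = (0, h))
    by (apply injective_projections; simpl; ring).
  assert (Ec : Cmod (0, h) = Rabs h).
  { replace (0, h) with (Ci * RtoC h)%C by (apply injective_projections; simpl; ring).
    rewrite Cmod_mult, Cmod_Ci, Cmod_R. ring. }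
  specialize (Hd' (x, t + h)). rewrite E, Ec in Hd'. specialize (Hd' Hlt).
  pose proof (im_le_Cmod (K (x, (t + h)%R) - K (x, t) - l * (0, h))%C) as Him.
  assert (Hp : 0 < Rabs h) by (apply Rabs_pos_lt; auto).
  match goal with |- Rabs ?q < _ =>
    replace q with (Im (K (x, (t + h)%R) - K (x, t) - l * (0, h))%C / h) end.
  - unfold Rdiv. rewrite Rabs_mult, Rabs_inv. apply Rdiv_lt_iff; auto. nra.
  - assert (Hg : forall u v : C, Im (u - v - l * (0, h))%C / h = (Im u - Im v) / h - Re l)
      by (intros [u1 u2] [v1 v2]; destruct l; simpl; field; auto).
    apply Hg.
Qed.

Lemma ratio_near_Re_pos (u v c : C) :
  Cmod (u - c)%C < Cmod c / 4 -> Cmod (v - c)%C < Cmod c / 4 -> 0 < Re (u / v)%C.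
Proof.
  intros Hu Hv. pose proof (Cmod_ge_0 (u - c)%C).
  pose proof (Cmod_minus_ge c v) as Hc. rewrite Cmod_minus_sym in Hc.
  assert (Hv0 : 0 < Cmod v) by lra. assert (Hvne : v <> RtoC 0) by (apply Cmod_gt_0; auto).
  pose proof (Cmod_minus_triangle u c v) as Huv. rewrite (Cmod_minus_sym c v) in Huv.
  assert (H1 : Cmod (u / v - RtoC 1)%C < 1).
  { replace (u / v - RtoC 1)%C with ((u - v) / v)%C by (field; auto).
    rewrite Cmod_div by auto. apply Rdiv_lt_iff; lra. }
  pose proof (Re_lipschitz (u / v)%C (RtoC 1)) as H2. apply Rabs_le_between in H2.
  rewrite re_RtoC in H2. lra.
Qed.

Lemma rotation_in_disk (z : C) (t : R) : Cmod (z * Cexp (0, t))%C = Cmod z.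
Proof. rewrite Cmod_mult, Cmod_Cexp. simpl. rewrite exp_0. ring. Qed.

(** For small angles, uniformly in [|z| <= r], the quotient
    [f (z e^{it}) / f z] stays in the half-plane where [Clog] is the logarithm. *)
Lemma rotation_quotient_Re_pos (f : C -> C) (r : R) :
  0 < r < 1 -> holomorphic_disk f -> (forall z, in_disk z -> f z <> RtoC 0) ->
  exists del, 0 < del /\ forall z, Cmod z <= r -> forall t, 0 <= t <= del ->
    0 < Re (f (z * Cexp (0, t)) / f z)%C.
Proof.
  intros Hr Hf Hne.
  apply (disk_uniform r (fun z del => forall t, 0 <= t <= del ->
    0 < Re (f (z * Cexp (0, t)) / f z)%C)); try lra.
  { intros z d d' Hd H t Ht. apply H. lra. }
  intros z0 Hz0. assert (Hz0d : in_disk z0) by (unfold in_disk; lra).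
  assert (Hc : 0 < Cmod (f z0)) by (apply Cmod_gt_0; auto).
  destruct (is_cderive_ccont f z0 _ (holomorphic_derive f z0 Hf Hz0d) (Cmod (f z0) / 4)) as [d [Hd H]]; [lra|].
  destruct (is_cderive_ccont _ _ _ is_cderive_Cexp_0 (d / 2)) as [e [He H2]]; [lra|].
  exists (Rmin (d / 2) (e / 2)). split; [apply Rmin_pos; lra|].
  pose proof (Rmin_l (d / 2) (e / 2)). pose proof (Rmin_r (d / 2) (e / 2)).
  intros z Hz Hzz t Ht. apply ratio_near_Re_pos with (f z0); [|apply H; lra].
  apply H.
  replace (z * Cexp (0, t) - z0)%C with (z * (Cexp (0, t) - RtoC 1) + (z - z0))%C by ring.
  eapply Rle_lt_trans; [apply Cmod_triangle|]. rewrite Cmod_mult.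
  assert (H3 : Cmod (Cexp (0, t) - RtoC 1)%C < d / 2).
  { rewrite <- Cexp_0. apply H2. eapply Rle_lt_trans;
      [apply (Cmod_rect (0 - 0) (t - 0))|].
    replace (0 - 0) with 0 by ring. rewrite Rabs_R0, Rminus_0_r, Rabs_pos_eq by lra. lra. }
  pose proof (Cmod_ge_0 z). pose proof (Cmod_ge_0 (Cexp (0, t) - RtoC 1)%C). nra.
Qed.

(** The increment of [log (f ^ (1 / mu) / (1 - z))] from [z] to [z e^zeta].  Only
    the quotient of the two values of [f] enters: for small [zeta] it is in
    the right half-plane, so no global logarithm of [f] has to be chosen. *)
Definition log_increment (mu : C) (f : C -> C) (z zeta : C) : C :=
  (/ mu * Clog (f (z * Cexp zeta) / f z) - Clog (RtoC 1 - z * Cexp zeta)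
   + Clog (RtoC 1 - z))%C.

Lemma is_cderive_log_increment (mu : C) (f : C -> C) (z zeta : C) :
  mu <> RtoC 0 -> holomorphic_disk f -> (forall w, in_disk w -> f w <> RtoC 0) ->
  in_disk z -> in_disk (z * Cexp zeta)%C -> 0 < Re (f (z * Cexp zeta) / f z)%C ->
  is_cderive (log_increment mu f z) zeta (logder mu f (z * Cexp zeta)).
Proof.
  intros Hmu Hf Hne Hz Hw Hre. set (w := (z * Cexp zeta)%C) in *.
  assert (Harg : is_cderive (fun u => z * Cexp u)%C zeta w)
    by (apply is_cderive_scal, is_cderive_Cexp).
  pose proof (one_minus_disk_neq0 w Hw) as H1.
  assert (Hlog1 : is_cderive (fun u => Clog (f (z * Cexp u) / f z))%C zeta
    (/ (f w / f z) * (C_derive f w * w * / f z))%C).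
  { apply (is_cderive_comp Clog (fun u => f (z * Cexp u) / f z)%C).
    - apply is_cderive_Clog. exact Hre.
    - replace (C_derive f w * w * / f z)%C with (/ f z * (C_derive f w * w))%C by ring.
      apply (is_cderive_ext_near (fun u => / f z * f (z * Cexp u))%C _ _ _ 1 Rlt_0_1).
      + intros u _. unfold Cdiv. ring.
      + apply is_cderive_scal. apply (is_cderive_comp f (fun u => z * Cexp u)%C); auto.
        apply holomorphic_derive; auto. }
  assert (Hlog2 : is_cderive (fun u => Clog (RtoC 1 - z * Cexp u))%C zeta
    (/ (RtoC 1 - w) * (RtoC 0 - w))%C).
  { apply (is_cderive_comp Clog (fun u => RtoC 1 - z * Cexp u)%C).
    - apply is_cderive_Clog, one_minus_disk_Re; auto.
    - apply is_cderive_minus; [apply is_cderive_const|auto]. }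
  replace (logder mu f w) with
    (/ mu * (/ (f w / f z) * (C_derive f w * w * / f z)) - / (RtoC 1 - w) * (RtoC 0 - w) + RtoC 0)%C.
  - apply is_cderive_plus; [|apply is_cderive_const].
    apply is_cderive_minus; auto. apply is_cderive_scal; auto.
  - unfold logder. field. repeat split; auto.
Qed.

Lemma log_increment_0 (mu : C) (f : C -> C) (z : C) :
  f z <> RtoC 0 -> log_increment mu f z (RtoC 0) = RtoC 0.
Proof.
  intros Hf. unfold log_increment. rewrite Cexp_0, Cmult_1_r.
  replace (f z / f z)%C with (RtoC 1) by (field; auto). rewrite Clog_1. ring.
Qed.

(** As a function of [z], for a fixed small angle, the increment is
    holomorphic although nothing is known about the regularity of [f']. *)
Lemma ex_cderive_log_increment (mu : C) (f : C -> C) (z : C) (t : R) :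
  holomorphic_disk f -> (forall w, in_disk w -> f w <> RtoC 0) ->
  in_disk z -> 0 < Re (f (z * Cexp (0, t)) / f z)%C ->
  ex_cderive (fun w => log_increment mu f w (0, t)) z.
Proof.
  intros Hf Hne Hz Hre. set (E := Cexp (0, t)) in *.
  assert (Hw : in_disk (z * E)%C) by (unfold in_disk, E; rewrite rotation_in_disk; exact Hz).
  assert (Hrot : is_cderive (fun w => w * E)%C z E).
  { pose proof (is_cderive_mult _ _ _ _ _ (is_cderive_id z) (is_cderive_const E z)) as H.
    cbv beta in H. replace (RtoC 1 * E + z * RtoC 0)%C with E in H by ring. exact H. }
  eexists. unfold log_increment. fold E. apply is_cderive_plus; [apply is_cderive_minus|].
  - apply is_cderive_scal. apply (is_cderive_comp Clog (fun w => f (w * E) / f w)%C).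
    + apply is_cderive_Clog. exact Hre.
    + apply is_cderive_div; auto.
      * apply (is_cderive_comp f (fun w => w * E)%C); [apply holomorphic_derive; auto|exact Hrot].
      * apply holomorphic_derive; auto.
  - apply (is_cderive_comp Clog (fun w => RtoC 1 - w * E)%C).
    + apply is_cderive_Clog, one_minus_disk_Re; auto.
    + apply is_cderive_minus; [apply is_cderive_const|exact Hrot].
  - apply (is_cderive_comp Clog (fun w => RtoC 1 - w)%C).
    + apply is_cderive_Clog, one_minus_disk_Re; auto.
    + apply is_cderive_minus; [apply is_cderive_const|apply is_cderive_id].
Qed.

(** The half-plane [Re Y >= - k / 2] is where [Y / (Y + k)] is in the unit disk. *)
Lemma Cmod_le_shift (Y : C) (k : R) : 0 <= k -> - k / 2 <= Re Y -> Cmod Y <= Cmod (Y + RtoC k)%C.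
Proof.
  intros Hk HY. apply Rsqr_incr_0; try apply Cmod_ge_0.
  rewrite !Rsqr_pow2, !Cmod_sqr. destruct Y as [a b]; simpl in *. nra.
Qed.

(** The bound of [logder_bound] for averages over arcs
    [{z e^{is} : 0 <= s <= t}].  The average is a difference quotient of logarithms, hence holomorphic in
    [z], and the real mean value theorem gives it the same lower bound on its
    real part as [logder], so Schwarz's lemma applies to it. *)
Lemma arc_average_bound (mu : C) (beta : R) (f : C -> C) (r t : R) :
  mu <> RtoC 0 -> beta < 1 -> classG mu beta f -> 0 < r < 1 -> 0 < t ->
  (forall z, Cmod z <= r -> forall s, 0 <= s <= t -> 0 < Re (f (z * Cexp (0, s)) / f z)%C) ->
  forall z, Cmod z < r ->
    let Y := (log_increment mu f z (0, t) / (0, t))%C in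
    r * Cmod Y <= Cmod z * Cmod (Y + RtoC (1 - beta))%C.
Proof.
  intros Hmu Hbeta HG Hr Ht Hpos.
  pose proof HG as [[Hf _] [_ [Hne _]]].
  assert (Hit : (0, t) <> RtoC 0) by (intro E; injection E; lra).
  set (Y := fun z => (log_increment mu f z (0, t) / (0, t))%C).
  assert (HYRe : forall z, Cmod z < r -> - (1 - beta) / 2 <= Re (Y z)).
  { intros z Hz. assert (Hzd : in_disk z) by (unfold in_disk; lra).
    assert (Hder : forall s, 0 <= s <= t ->
      is_derive (fun s => Im (log_increment mu f z (0, s))) s (Re (logder mu f (z * Cexp (0, s))%C))).
    { intros s Hs. apply vertical_derive, is_cderive_log_increment; auto.
      - unfold in_disk. rewrite rotation_in_disk. exact Hzd.
      - apply Hpos; lra. }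
    destruct (MVT_gen (fun s => Im (log_increment mu f z (0, s))) 0 t
      (fun s => Re (logder mu f (z * Cexp (0, s))%C))) as [s [Hs Heq]].
    - intros s. rewrite Rmin_left, Rmax_right by lra. intros Hs. apply Hder; lra.
    - intros s. rewrite Rmin_left, Rmax_right by lra. intros Hs.
      apply continuity_pt_filterlim, (ex_derive_continuous (V := R_NormedModule)).
      eexists; apply Hder; lra.
    - rewrite Rmin_left, Rmax_right in Hs by lra.
      change (0, 0) with (RtoC 0) in Heq. rewrite log_increment_0 in Heq by auto.
      change (Im (RtoC 0)) with 0 in Heq.
      assert (Hb : - (1 - beta) / 2 < Re (logder mu f (z * Cexp (0, s))%C)).
      { apply classG_logder; auto. unfold in_disk. rewrite rotation_in_disk. exact Hzd. }
      replace (Re (Y z)) with (Re (logder mu f (z * Cexp (0, s))%C)); [lra|].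
      apply Rmult_eq_reg_r with t; [|lra].
      replace (Re (logder mu f (z * Cexp (0, s))%C) * t)
        with (Im (log_increment mu f z (0, t))) by lra.
      unfold Y. destruct (log_increment mu f z (0, t)) as [a b]. simpl. field. lra. }
  assert (Hk : 0 < 1 - beta) by lra.
  assert (Hden : forall z, Cmod z < r -> (Y z + RtoC (1 - beta))%C <> RtoC 0).
  { intros z Hz. apply Re_pos_neq_0. rewrite re_plus, re_RtoC. specialize (HYRe z Hz). lra. }
  intros z Hz. change (r * Cmod (Y z) <= Cmod z * Cmod (Y z + RtoC (1 - beta))%C).
  pose proof (schwarz_lemma (fun z => Y z / (Y z + RtoC (1 - beta)))%C r) as HS. simpl in HS.
  assert (Hfin : r * Cmod (Y z / (Y z + RtoC (1 - beta)))%C <= Cmod z).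
  { apply HS; auto; try lra.
    - intros w Hw. destruct (ex_cderive_log_increment mu f w t) as [l Hl]; auto.
      { unfold in_disk; lra. }
      { apply Hpos; lra. }
      assert (HYd : is_cderive Y w (/ (0, t) * l)%C).
      { apply (is_cderive_ext_near (fun w => / (0, t) * log_increment mu f w (0, t))%C _ _ _ 1 Rlt_0_1).
        - intros u _. unfold Y, Cdiv. ring.
        - apply is_cderive_scal. exact Hl. }
      eexists. apply is_cderive_div; [exact HYd| |auto].
      apply is_cderive_plus; [exact HYd|apply is_cderive_const].
    - replace (Y (RtoC 0)) with (RtoC 0); [unfold Cdiv; ring|].
      unfold Y, log_increment. rewrite Cmult_0_l.
      assert (f (RtoC 0) <> RtoC 0) by (apply Hne; unfold in_disk; rewrite Cmod_0; lra).
      replace (f (RtoC 0) / f (RtoC 0))%C with (RtoC 1) by (field; auto).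
      rewrite Clog_1. unfold Cdiv. ring.
    - intros w Hw. rewrite Cmod_div by auto.
      apply Rdiv_le_iff; [apply Cmod_gt_0; auto|]. rewrite Rmult_1_l.
      apply Cmod_le_shift; auto. lra. }
  rewrite Cmod_div in Hfin by auto. unfold Rdiv in Hfin. rewrite <- Rmult_assoc in Hfin.
  apply Rdiv_le_iff in Hfin; auto. apply Cmod_gt_0; auto.
Qed.

(** The average over an arc tends to the value at its origin as the arc shrinks;
    then the radius of the disk tends to [1]. *)
Lemma logder_bound (mu : C) (beta : R) (f : C -> C) (z : C) :
  mu <> RtoC 0 -> beta < 1 -> classG mu beta f -> in_disk z ->
  Cmod (logder mu f z) <= Cmod z * Cmod (logder mu f z + RtoC (1 - beta))%C.
Proof.
  intros Hmu Hbeta HG Hz. pose proof HG as [[Hf _] [_ [Hne _]]].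
  set (X := logder mu f z). pose proof (Cmod_ge_0 z) as Hz0.
  assert (Hr : forall r, Cmod z < r < 1 -> r * Cmod X <= Cmod z * Cmod (X + RtoC (1 - beta))%C).
  { intros r Hr. apply le_epsilon. intros eps Heps.
    destruct (rotation_quotient_Re_pos f r) as [d [Hd Hpos]]; auto; [lra|].
    assert (HX : is_cderive (log_increment mu f z) (RtoC 0) X).
    { pose proof (is_cderive_log_increment mu f z (RtoC 0)) as H.
      rewrite Cexp_0, Cmult_1_r in H. apply H; auto.
      replace (f z / f z)%C with (RtoC 1) by (field; auto). simpl. lra. }
    destruct (proj1 (is_cderive_eps _ _ _) HX (eps / 2)) as [d' [Hd' Hlin]]; [lra|].
    set (t := Rmin d (d' / 2)). assert (Ht : 0 < t) by (apply Rmin_pos; lra).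
    assert (Ht1 : t <= d) by apply Rmin_l. assert (Ht2 : t <= d' / 2) by apply Rmin_r.
    pose proof (arc_average_bound mu beta f r t Hmu Hbeta HG ltac:(lra) Ht
      ltac:(intros w Hw s Hs; apply Hpos; [auto|lra]) z ltac:(lra)) as HY. simpl in HY.
    set (Y := (log_increment mu f z (0, t) / (0, t))%C) in *.
    assert (Hit : (0, t) <> RtoC 0) by (intro E; injection E; lra).
    assert (Hct : Cmod (0, t) = t).
    { replace (0, t) with (Ci * RtoC t)%C by (apply injective_projections; simpl; ring).
      rewrite Cmod_mult, Cmod_Ci, Cmod_R, Rabs_pos_eq; lra. }
    assert (HYX : Cmod (Y - X)%C <= eps / 2).
    { specialize (Hlin (0, t)). rewrite log_increment_0 in Hlin by auto.
      replace ((0, t) - RtoC 0)%C with (0, t) in Hlin by (apply injective_projections; simpl; ring).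
      specialize (Hlin ltac:(lra)).
      replace (Y - X)%C with ((log_increment mu f z (0, t) - RtoC 0 - X * (0, t)) / (0, t))%C
        by (unfold Y; field; auto).
      rewrite Cmod_div by auto. apply Rdiv_le_iff; [lra|exact Hlin]. }
    pose proof (Cmod_minus_ge X Y) as H1. rewrite Cmod_minus_sym in H1.
    pose proof (Cmod_triangle (X + RtoC (1 - beta))%C (Y - X)%C) as H2.
    replace (X + RtoC (1 - beta) + (Y - X))%C with (Y + RtoC (1 - beta))%C in H2 by ring.
    assert (r * Cmod X <= r * (Cmod Y + eps / 2)) by (apply Rmult_le_compat_l; lra).
    assert (Cmod z * Cmod (Y + RtoC (1 - beta))%C
      <= Cmod z * (Cmod (X + RtoC (1 - beta))%C + eps / 2)) by (apply Rmult_le_compat_l; lra).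
    unfold in_disk in Hz. nra. }
  apply Rnot_lt_le. intro Hlt. unfold in_disk in Hz.
  set (B := Cmod z * Cmod (X + RtoC (1 - beta))%C) in *.
  assert (HB : 0 <= B) by (apply Rmult_le_pos; apply Cmod_ge_0).
  set (r := Rmax ((Cmod z + 1) / 2) ((B / Cmod X + 1) / 2)).
  assert (HBX : B / Cmod X < 1) by (apply Rdiv_lt_iff; lra).
  assert (Hr1 : (Cmod z + 1) / 2 <= r) by apply Rmax_l.
  assert (Hr2 : (B / Cmod X + 1) / 2 <= r) by apply Rmax_r.
  assert (Hr3 : r < 1) by (apply Rmax_lub_lt; lra).
  specialize (Hr r ltac:(lra)).
  assert (Hlt2 : B / Cmod X < r) by lra. apply Rdiv_lt_iff in Hlt2; lra.
Qed.


(** * The extremal function *)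

Lemma is_cderive_f0 (mu : C) (beta : R) (z : C) : in_disk z ->
  is_cderive (f0 mu beta) z (- (mu * RtoC beta) / (RtoC 1 - z) * f0 mu beta z)%C.
Proof.
  intros Hz. pose proof (one_minus_disk_neq0 z Hz) as H1.
  assert (HL : is_cderive (fun w => (mu * RtoC beta) * Clog (RtoC 1 - w))%C z
    ((mu * RtoC beta) * (/ (RtoC 1 - z) * (RtoC 0 - RtoC 1)))%C).
  { apply is_cderive_scal. apply (is_cderive_comp Clog (fun w => RtoC 1 - w)%C).
    - apply is_cderive_Clog, one_minus_disk_Re; auto.
    - apply is_cderive_minus; [apply is_cderive_const|apply is_cderive_id]. }
  pose proof (is_cderive_comp Cexp _ z _ _ (is_cderive_Cexp _) HL) as H.
  replace (- (mu * RtoC beta) / (RtoC 1 - z) * f0 mu beta z)%C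
    with (Cexp (mu * RtoC beta * Clog (RtoC 1 - z)) *
      ((mu * RtoC beta) * (/ (RtoC 1 - z) * (RtoC 0 - RtoC 1))))%C; [exact H|].
  unfold f0, pow_one_minus. field; auto.
Qed.

Lemma f0_neq_0 (mu : C) (beta : R) (z : C) : f0 mu beta z <> RtoC 0.
Proof. apply Cexp_neq_0. Qed.

Lemma f0_holomorphic (mu : C) (beta : R) : holomorphic_disk (f0 mu beta).
Proof. intros z Hz. eexists. apply is_cderive_f0; auto. Qed.

Lemma f0_at_0 (mu : C) (beta : R) : f0 mu beta (RtoC 0) = RtoC 1.
Proof. apply pow_one_minus_0. Qed.

Lemma Omega_Re_inv (mu : C) : Omega mu -> 1 / 2 <= Re (/ mu)%C.
Proof.
  intros [H Hne]. assert (Hm : 0 < Cmod mu ^ 2) by (apply pow_lt, Cmod_gt_0; auto).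
  assert (H2 : Cmod (mu - RtoC 1)%C ^ 2 <= 1).
  { pose proof (Cmod_ge_0 (mu - RtoC 1)%C). simpl. nra. }
  rewrite Cmod_sqr in Hm, H2. destruct mu as [a b]. simpl in *.
  apply Rmult_le_reg_r with (a * (a * 1) + b * (b * 1)); auto.
  unfold Rdiv. rewrite (Rmult_assoc a), Rinv_l by lra. lra.
Qed.

(** The imaginary parts of [log (1 - z)] and [log (1 - w)] differ by less than
    [PI].  Equal values of [f0] force these logarithms to differ by
    [2 PI i k / (mu beta)] for an integer [k], whose imaginary part has modulus
    at least [PI |k| / beta], because [Re (1 / mu) >= 1 / 2] on [Omega]. *)
Lemma f0_injective (mu : C) (beta : R) (z w : C) :
  Omega mu -> 0 < beta < 1 -> in_disk z -> in_disk w ->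
  f0 mu beta z = f0 mu beta w -> z = w.
Proof.
  intros HO Hb Hz Hw Heq. pose proof (Omega_Re_inv mu HO) as Hinv. destruct HO as [_ Hmu].
  assert (Hbne : RtoC beta <> RtoC 0) by (intro E; injection E; lra).
  set (d := (Clog (RtoC 1 - z) - Clog (RtoC 1 - w))%C).
  assert (Hd : Rabs (Im d) < PI).
  { unfold d, Clog. simpl. set (x := _ / _). set (y := _ / _).
    pose proof (atan_bound x). pose proof (atan_bound y). apply Rabs_def1; lra. }
  set (u := (mu * RtoC beta * d)%C).
  assert (Hu : Cexp u = RtoC 1).
  { unfold u, d. replace (mu * RtoC beta * (Clog (RtoC 1 - z) - Clog (RtoC 1 - w)))%C
      with (mu * RtoC beta * Clog (RtoC 1 - z) - mu * RtoC beta * Clog (RtoC 1 - w))%C by ring.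
    rewrite Cexp_minus. change ((f0 mu beta z / f0 mu beta w)%C = RtoC 1).
    rewrite Heq. field. apply f0_neq_0. }
  assert (Hre : Re u = 0).
  { assert (E : Cmod (Cexp u) = 1) by (rewrite Hu; apply Cmod_1).
    rewrite Cmod_Cexp in E. rewrite <- exp_0 in E. apply exp_inv in E; auto. }
  assert (Hdu : beta * Im d = Im u * Re (/ mu)%C).
  { replace (beta * Im d) with (Im (RtoC beta * d)%C) by (destruct d; simpl; ring).
    replace (RtoC beta * d)%C with (u * / mu)%C by (unfold u; field; auto).
    rewrite im_mult, Hre. ring. }
  assert (Hu0 : u = RtoC 0).
  { apply Cexp_eq_1; auto. apply Rnot_le_lt. intro Hge.
    assert (E : Rabs (beta * Im d) = Rabs (Im u) * Re (/ mu)%C)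
      by (rewrite Hdu, Rabs_mult; f_equal; apply Rabs_pos_eq; lra).
    rewrite Rabs_mult, (Rabs_pos_eq beta) in E by lra. pose proof PI_RGT_0. nra. }
  assert (Hd0 : d = RtoC 0).
  { replace d with (u / (mu * RtoC beta))%C by (unfold u; field; auto).
    rewrite Hu0. unfold Cdiv; ring. }
  assert (E : (RtoC 1 - z)%C = (RtoC 1 - w)%C).
  { rewrite <- (Cexp_Clog (RtoC 1 - z)), <- (Cexp_Clog (RtoC 1 - w))
      by (apply one_minus_disk_Re; auto).
    f_equal. replace (Clog (RtoC 1 - z)) with (d + Clog (RtoC 1 - w))%C by (unfold d; ring).
    rewrite Hd0; ring. }
  replace z with (RtoC 1 - (RtoC 1 - z))%C by ring. rewrite E; ring.
Qed.

Lemma Re_half_plane_map (z : C) : in_disk z -> 0 < Re ((RtoC 1 + z) / (RtoC 1 - z))%C.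
Proof.
  intros Hz. pose proof (one_minus_disk_neq0 z Hz) as H1. apply Cmod_gt_0 in H1.
  assert (H2 : 0 < Cmod (RtoC 1 - z)%C ^ 2) by (apply pow_lt; auto).
  assert (H3 : Cmod z ^ 2 < 1).
  { unfold in_disk in Hz. pose proof (Cmod_ge_0 z). simpl. nra. }
  rewrite Cmod_sqr in H2, H3. destruct z as [a b]. simpl in *.
  match goal with |- 0 < ?e =>
    replace e with ((1 - (a * (a * 1) + b * (b * 1))) /
      ((1 + - a) * ((1 + - a) * 1) + (0 + - b) * ((0 + - b) * 1))) by (field; lra) end.
  apply Rdiv_lt_0_compat; lra.
Qed.

Lemma f0_classG (mu : C) (beta : R) :
  Omega mu -> 0 < beta < 1 -> classG mu beta (f0 mu beta).
Proof.
  intros HO Hb. assert (Hmu : mu <> RtoC 0) by apply HO. repeat split.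
  - apply f0_holomorphic.
  - intros z w Hz Hw. apply f0_injective; auto.
  - apply f0_at_0.
  - intros z _. apply f0_neq_0.
  - intros z Hz. pose proof (one_minus_disk_neq0 z Hz) as H1.
    rewrite (is_C_derive_unique _ _ _ (is_cderive_f0 mu beta z Hz)).
    replace (RtoC 2 / mu * (z * (- (mu * RtoC beta) / (RtoC 1 - z) * f0 mu beta z) / f0 mu beta z)
      + (RtoC 1 + z) / (RtoC 1 - z))%C
      with (RtoC beta + RtoC (1 - beta) * ((RtoC 1 + z) / (RtoC 1 - z)))%C.
    + rewrite re_plus, re_RtoC, re_scal_l. pose proof (Re_half_plane_map z Hz). nra.
    + rewrite RtoC_minus. field. repeat split; auto. apply f0_neq_0.
Qed.

Lemma classG_monotone (mu : C) (beta beta' : R) (f : C -> C) :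
  beta' <= beta -> classG mu beta f -> classG mu beta' f.
Proof.
  intros Hb [Hu [H0 [Hne Hre]]]. repeat split; auto; try apply Hu.
  intros z Hz. specialize (Hre z Hz). lra.
Qed.

(** * Functions of the class: derivative, openness and inverse *)

(** Strict convexity of the disk [|x - 1| <= r |x|], the image of [|u| <= r]
    under [u => 1 / (1 - u)].  The combination is of [a], [c] and [1]; the last
    two are interior, [1] being the image of the centre, and they have total
    weight [beta > 0]. *)
Lemma apollonius_convex (r beta m : R) (a b c : C) :
  0 < r < 1 -> 0 < beta < 1 -> 0 <= m <= 1 ->
  Cmod (a - RtoC 1)%C <= r * Cmod a -> Cmod (c - RtoC 1)%C < r * Cmod c ->
  b = (RtoC (1 - beta) * a + RtoC (beta * m) * c + RtoC (beta * (1 - m)))%C ->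
  Cmod (b - RtoC 1)%C < r * Cmod b.
Proof.
  intros Hr Hb Hm Ha Hc Eb.
  set (phi := fun x : C => Cmod (x - RtoC 1)%C ^ 2 - r ^ 2 * Cmod x ^ 2).
  assert (Pa : phi a <= 0).
  { unfold phi. pose proof (Cmod_ge_0 (a - RtoC 1)%C). pose proof (Cmod_ge_0 a). nra. }
  assert (Pc : phi c < 0).
  { unfold phi. pose proof (Cmod_ge_0 (c - RtoC 1)%C). pose proof (Cmod_ge_0 c). nra. }
  assert (Id : phi b = (1 - beta) * phi a + beta * m * phi c - beta * (1 - m) * r ^ 2
     - (1 - r ^ 2) * ((1 - beta) * (beta * m) * Cmod (a - c)%C ^ 2
       + (1 - beta) * (beta * (1 - m)) * Cmod (a - RtoC 1)%C ^ 2
       + (beta * m) * (beta * (1 - m)) * Cmod (c - RtoC 1)%C ^ 2)).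
  { rewrite Eb. unfold phi. rewrite !Cmod_sqr. destruct a, c. simpl. ring. }
  assert (Hr2 : 0 < r ^ 2 < 1) by (simpl; nra).
  assert (Q : 0 <= (1 - r ^ 2) * ((1 - beta) * (beta * m) * Cmod (a - c)%C ^ 2
       + (1 - beta) * (beta * (1 - m)) * Cmod (a - RtoC 1)%C ^ 2
       + (beta * m) * (beta * (1 - m)) * Cmod (c - RtoC 1)%C ^ 2)).
  { apply Rmult_le_pos; [lra|].
    repeat apply Rplus_le_le_0_compat; (apply Rmult_le_pos; [|apply pow2_ge_0]);
      repeat apply Rmult_le_pos; lra. }
  assert (Pb : phi b < 0).
  { rewrite Id.
    assert (0 <= (1 - beta) * - phi a) by (apply Rmult_le_pos; lra).
    assert (0 < beta * (m * - phi c + (1 - m) * r ^ 2)).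
    { apply Rmult_lt_0_compat; [lra|].
      destruct (Rle_lt_dec m (1 / 2)).
      - assert (0 <= m * - phi c) by (apply Rmult_le_pos; lra).
        assert (0 < (1 - m) * r ^ 2) by (apply Rmult_lt_0_compat; lra). lra.
      - assert (0 < m * - phi c) by (apply Rmult_lt_0_compat; lra).
        assert (0 <= (1 - m) * r ^ 2) by (apply Rmult_le_pos; lra). lra. }
    nra. }
  unfold phi in Pb. apply Rsqr_incrst_0; [|apply Cmod_ge_0|apply Rmult_le_pos; [lra|apply Cmod_ge_0]].
  rewrite !Rsqr_pow2, Rpow_mult_distr. lra.
Qed.

Lemma apollonius_image (u : C) : in_disk u ->
  Cmod (/ (RtoC 1 - u) - RtoC 1)%C = Cmod u * Cmod (/ (RtoC 1 - u))%C.
Proof.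
  intros Hu. rewrite <- Cmod_mult. f_equal. field. apply one_minus_disk_neq0; auto.
Qed.

(** With [a = 1 + logder mu f w / (1 - beta)], the bound on [logder] says
    that [a] lies in the Apollonius disk of ratio [|w|], on whose boundary
    [1 / (1 - w)] lies; the excluded equality would write this boundary point
    as a convex combination of [a], [1 / (1 - zeta)] and [1]. *)
Lemma logarithmic_derivative_avoids (mu : C) (beta m : R) (f : C -> C) (w zeta : C) :
  mu <> RtoC 0 -> 0 < beta < 1 -> classG mu beta f ->
  in_disk w -> in_disk zeta -> Cmod zeta < Cmod w -> 0 <= m <= 1 ->
  (w * C_derive f w / (mu * f w))%C <> (- RtoC (beta * m) * (zeta / (RtoC 1 - zeta)))%C.
Proof.
  intros Hmu Hb HG Hw Hz Hlt Hm Heq.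
  pose proof (one_minus_disk_neq0 w Hw) as Hw1. pose proof (one_minus_disk_neq0 zeta Hz) as Hz1.
  pose proof (logder_bound mu beta f w Hmu ltac:(lra) HG Hw) as HX.
  unfold logder in HX. rewrite Heq in HX.
  set (X := (- RtoC (beta * m) * (zeta / (RtoC 1 - zeta)) + w / (RtoC 1 - w))%C) in *.
  pose proof (Cmod_ge_0 zeta) as Hz0.
  assert (Hbne : RtoC (1 - beta) <> RtoC 0) by (intro E; injection E; lra).
  apply (Rlt_irrefl (Cmod (/ (RtoC 1 - w) - RtoC 1)%C)).
  rewrite (apollonius_image w Hw) at 2.
  apply (apollonius_convex (Cmod w) beta m (RtoC 1 + X / RtoC (1 - beta))%C
    (/ (RtoC 1 - w))%C (/ (RtoC 1 - zeta))%C); auto.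
  - unfold in_disk in Hw. lra.
  - replace (RtoC 1 + X / RtoC (1 - beta) - RtoC 1)%C with (X / RtoC (1 - beta))%C by (field; auto).
    replace (RtoC 1 + X / RtoC (1 - beta))%C with ((X + RtoC (1 - beta)) / RtoC (1 - beta))%C
      by (field; auto).
    rewrite !Cmod_div by auto. unfold Rdiv. rewrite <- Rmult_assoc.
    apply Rmult_le_compat_r; auto. apply Rlt_le, Rinv_0_lt_compat, Cmod_gt_0; auto.
  - rewrite (apollonius_image zeta Hz). apply Rmult_lt_compat_r; auto.
    apply Cmod_gt_0. apply Cmod_gt_0. rewrite Cmod_inv by auto.
    apply Rinv_0_lt_compat, Cmod_gt_0; auto.
  - unfold X. rewrite !RtoC_minus, !RtoC_mult, !RtoC_minus in *. field. auto.
Qed.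

(** By the real mean value theorem on a segment ending at the origin, a bound
    on the derivative off a point passes to that point, even where the
    derivative might be discontinuous. *)
Lemma derive_bound_at_0 (h : C -> C) (l : C) (M del : R) :
  0 < del -> is_cderive h (RtoC 0) l ->
  (forall z, 0 < Cmod z < del -> exists l', is_cderive h z l' /\ Cmod l' <= M) ->
  Cmod l <= M.
Proof.
  intros Hdel Hl Hd.
  destruct (Rle_lt_dec (Cmod l) 0) as [Hl0|Hl0].
  { destruct (Hd (RtoC (del / 2))) as [l' [_ Hl']].
    - rewrite Cmod_R, Rabs_pos_eq; lra.
    - pose proof (Cmod_ge_0 l'). lra. }
  apply le_epsilon. intros eps Heps.
  destruct (proj1 (is_cderive_eps _ _ _) Hl eps Heps) as [e [He Hlin]].
  set (t := Rmin (del / 2) (e / 2)). assert (Ht : 0 < t) by (apply Rmin_pos; lra).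
  assert (Ht1 : t <= del / 2) by apply Rmin_l. assert (Ht2 : t <= e / 2) by apply Rmin_r.
  assert (Hcs : forall s, 0 <= s -> Cmod (0, s) = s).
  { intros s Hs. replace (0, s) with (Ci * RtoC s)%C by (apply injective_projections; simpl; ring).
    rewrite Cmod_mult, Cmod_Ci, Cmod_R, Rabs_pos_eq; lra. }
  (* Real mean value theorem for the component of h in the direction of l. *)
  destruct (MVT_cor2 (fun s => Im (Cconj l * h (0, s))%C)
    (fun s => Re (Cconj l * C_derive h (0, s))%C) 0 t Ht) as [s [Heq Hs]].
  { intros s Hs. apply is_derive_Reals.
    apply (vertical_derive (fun z => Cconj l * h z)%C). apply is_cderive_scal.
    apply C_derive_correct; [exact l|].
    destruct (Req_dec s 0) as [->|Hs0]; [exists l; exact Hl|].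
    destruct (Hd (0, s)) as [l' [Hl' _]]; [rewrite Hcs; lra|exists l'; exact Hl']. }
  destruct (Hd (0, s)) as [l' [Hl' HM]]; [rewrite Hcs; lra|].
  rewrite (is_C_derive_unique _ _ _ Hl') in Heq.
  assert (H1 : Re (Cconj l * l')%C <= Cmod l * M).
  { eapply Rle_trans; [apply Rle_abs|]. eapply Rle_trans; [apply re_le_Cmod|].
    rewrite Cmod_mult, Cmod_conj. apply Rmult_le_compat_l; lra. }
  specialize (Hlin (0, t)).
  replace ((0, t) - RtoC 0)%C with (0, t) in Hlin by (apply injective_projections; simpl; ring).
  rewrite Hcs in Hlin by lra. specialize (Hlin ltac:(lra)).
  pose proof (im_le_Cmod (Cconj l * (h (0, t) - h (RtoC 0) - l * (0, t)))%C) as H2.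
  rewrite Cmod_mult, Cmod_conj in H2. apply Rabs_le_between in H2.
  assert (H3 : Im (Cconj l * (h (0, t) - h (RtoC 0) - l * (0, t)))%C
    = Im (Cconj l * h (0, t))%C - Im (Cconj l * h (0, 0))%C - Cmod l ^ 2 * t).
  { change (0, 0) with (RtoC 0). rewrite Cmod_sqr.
    destruct (h (0, t)), (h (RtoC 0)), l. simpl. ring. }
  rewrite H3, Heq in H2.
  assert (H4 : Cmod l * Cmod (h (0, t) - h (RtoC 0) - l * (0, t))%C <= Cmod l * (eps * t))
    by (apply Rmult_le_compat_l; lra).
  assert (H5 : Cmod l ^ 2 * t <= Cmod l * (M + eps) * t) by (simpl; nra).
  apply Rmult_le_reg_l with (Cmod l); auto. apply Rmult_le_reg_r with t; auto. simpl in H5. nra.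
Qed.

(** [logder_bound] divided by [|z|] says nothing at the origin, but off it bounds
    the derivative of [log (f ^ (1 / mu) / (1 - z))] by about [1 - beta];
    at the origin this derivative is [f' 0 / mu + 1]. *)
Lemma classG_derive_0 (mu : C) (beta : R) (f : C -> C) :
  mu <> RtoC 0 -> 0 < beta < 1 -> classG mu beta f ->
  beta * Cmod mu <= Cmod (C_derive f (RtoC 0)).
Proof.
  intros Hmu Hb HG. pose proof HG as [[Hf _] [Hf0 [Hne _]]].
  assert (H0d : in_disk (RtoC 0)) by (unfold in_disk; rewrite Cmod_0; lra).
  destruct (is_cderive_ccont f _ _ (holomorphic_derive f _ Hf H0d) 1 Rlt_0_1) as [d1 [Hd1 Hpos]].
  rewrite Hf0 in Hpos.
  set (h := fun z => (/ mu * Clog (f z) - Clog (RtoC 1 - z))%C).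
  assert (Hh : forall z, in_disk z -> Cmod z < d1 ->
    is_cderive h z (/ mu * (/ f z * C_derive f z) - / (RtoC 1 - z) * (RtoC 0 - RtoC 1))%C).
  { intros z Hz Hzd. apply is_cderive_minus.
    - apply is_cderive_scal. apply (is_cderive_comp Clog f); [|apply holomorphic_derive; auto].
      apply is_cderive_Clog.
      assert (Hz' : Cmod (f z - RtoC 1)%C < 1)
        by (apply Hpos; replace (z - RtoC 0)%C with z by ring; auto).
      pose proof (Re_lipschitz (f z) (RtoC 1)) as H. rewrite re_RtoC in H.
      apply Rabs_le_between in H. lra.
    - apply (is_cderive_comp Clog (fun w => RtoC 1 - w)%C).
      + apply is_cderive_Clog, one_minus_disk_Re; auto.
      + apply is_cderive_minus; [apply is_cderive_const|apply is_cderive_id]. }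
  assert (Hl : Cmod (C_derive f (RtoC 0) / mu + RtoC 1)%C <= 1 - beta).
  { apply le_epsilon. intros eps Heps.
    set (del := Rmin (Rmin d1 (1 / 2)) (eps / 2)).
    assert (Hdel : 0 < del) by (repeat apply Rmin_pos; lra).
    assert (D1 : del <= d1) by (unfold del; eapply Rle_trans; [apply Rmin_l|apply Rmin_l]).
    assert (D2 : del <= 1 / 2) by (unfold del; eapply Rle_trans; [apply Rmin_l|apply Rmin_r]).
    assert (D3 : del <= eps / 2) by apply Rmin_r.
    apply (derive_bound_at_0 h _ _ del); auto.
    - replace (C_derive f (RtoC 0) / mu + RtoC 1)%C with
        (/ mu * (/ f (RtoC 0) * C_derive f (RtoC 0))
         - / (RtoC 1 - RtoC 0) * (RtoC 0 - RtoC 1))%C; [apply Hh; auto; rewrite Cmod_0; lra|].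
      rewrite Hf0. field. repeat split; auto; intro E; injection E; lra.
    - intros z Hz. assert (Hzd : in_disk z) by (unfold in_disk; lra).
      eexists. split; [apply Hh; auto; lra|].
      set (W := (/ mu * (/ f z * C_derive f z) - / (RtoC 1 - z) * (RtoC 0 - RtoC 1))%C).
      pose proof (one_minus_disk_neq0 z Hzd) as Hz1.
      assert (EX : logder mu f z = (z * W)%C)
        by (unfold W, logder; field; repeat split; auto).
      pose proof (logder_bound mu beta f z Hmu ltac:(lra) HG Hzd) as HX.
      rewrite EX, Cmod_mult in HX. apply Rmult_le_reg_l in HX; [|lra].
      pose proof (Cmod_triangle (z * W)%C (RtoC (1 - beta))) as HT.
      rewrite Cmod_mult, Cmod_R, Rabs_pos_eq in HT by lra.
      pose proof (Cmod_ge_0 W).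
      assert (HW : Cmod W * (1 - Cmod z) <= 1 - beta) by lra.
      assert (Cmod W <= 2) by nra. nra. }
  pose proof (Cmod_triangle (C_derive f (RtoC 0) / mu + RtoC 1)%C (- (C_derive f (RtoC 0) / mu))%C) as HT.
  replace (C_derive f (RtoC 0) / mu + RtoC 1 + - (C_derive f (RtoC 0) / mu))%C with (RtoC 1) in HT by ring.
  rewrite Cmod_1, Cmod_opp, Cmod_div in HT by auto.
  assert (Hm : 0 < Cmod mu) by (apply Cmod_gt_0; auto).
  assert (Hq : beta <= Cmod (C_derive f (RtoC 0)) / Cmod mu) by lra.
  apply (Rmult_le_compat_r (Cmod mu)) in Hq; [|lra].
  unfold Rdiv in Hq. rewrite Rmult_assoc, Rinv_l, Rmult_1_r in Hq by lra. exact Hq.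
Qed.

Lemma classG_derive_neq_0 (mu : C) (beta : R) (f : C -> C) (w : C) :
  mu <> RtoC 0 -> 0 < beta < 1 -> classG mu beta f -> in_disk w ->
  C_derive f w <> RtoC 0.
Proof.
  intros Hmu Hb HG Hw E. destruct (Rle_lt_dec (Cmod w) 0) as [H0|H0].
  - assert (w = RtoC 0) as -> by (apply Cmod_eq_0; pose proof (Cmod_ge_0 w); lra).
    pose proof (classG_derive_0 mu beta f Hmu Hb HG) as H. rewrite E, Cmod_0 in H.
    apply Cmod_gt_0 in Hmu. nra.
  - apply (logarithmic_derivative_avoids mu beta 0 f w (RtoC 0)); auto; try lra.
    + unfold in_disk; rewrite Cmod_0; lra.
    + rewrite Cmod_0; auto.
    + rewrite E, Rmult_0_r. unfold Cdiv. ring.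
Qed.

(** At a minimum [w] of [|f w - y|] where the derivative does not vanish, a step in the direction
    of [(y - f w) / f' w] would come closer to [y], unless [f w = y]. *)
Lemma local_surjectivity (f : C -> C) (w0 : C) (eta : R) :
  0 < eta ->
  (forall w, Cmod (w - w0)%C < eta -> exists l, l <> RtoC 0 /\ is_cderive f w l) ->
  exists del, 0 < del /\ forall y, Cmod (y - f w0)%C < del ->
    exists w, Cmod (w - w0)%C < eta /\ f w = y.
Proof.
  intros Heta Hf.
  destruct (Hf w0) as [l0 [Hl0 Hd0]].
  { replace (w0 - w0)%C with (RtoC 0) by ring. rewrite Cmod_0. auto. }
  assert (HL : 0 < Cmod l0) by (apply Cmod_gt_0; auto).
  destruct (proj1 (is_cderive_eps _ _ _) Hd0 (Cmod l0 / 2)) as [e [He Hlin]]; [lra|].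
  set (d := Rmin (eta / 2) (e / 2)). assert (Hd : 0 < d) by (apply Rmin_pos; lra).
  assert (Hde : d <= eta / 2) by apply Rmin_l. assert (Hd2 : d <= e / 2) by apply Rmin_r.
  exists (Cmod l0 * d / 4). split; [assert (0 < Cmod l0 * d) by (apply Rmult_lt_0_compat; auto); lra|].
  intros y Hy.
  assert (Hsub : forall u, (w0 + u - w0)%C = u) by (intros; ring).
  destruct (disk_max (fun u => - Cmod (f (w0 + u) - y)%C) d Hd) as [u1 [Hu1 Hmin]].
  { intros u Hu eps Heps. destruct (Hf (w0 + u)%C) as [l [_ Hl]]; [rewrite Hsub; lra|].
    destruct (is_cderive_ccont _ _ _ Hl eps Heps) as [b [Hb Hc]].
    exists b; split; auto. intros v Hv Hvu. specialize (Hc (w0 + v)%C).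
    replace (w0 + v - (w0 + u))%C with (v - u)%C in Hc by ring. specialize (Hc Hvu).
    pose proof (Cmod_minus_triangle (f (w0 + u)%C) (f (w0 + v)%C) y) as HT.
    rewrite (Cmod_minus_sym (f (w0 + u)%C) (f (w0 + v)%C)) in HT. lra. }
  exists (w0 + u1)%C. split; [rewrite Hsub; lra|].
  set (w1 := (w0 + u1)%C) in *.
  apply NNPP. intro Hne.
  set (q := (y - f w1)%C).
  assert (Hq : q <> RtoC 0).
  { intro E. apply Hne. replace (f w1) with (y - q)%C by (unfold q; ring). rewrite E; ring. }
  assert (Hqp : 0 < Cmod q) by (apply Cmod_gt_0; auto).
  assert (Hqe : Cmod (f w1 - y)%C = Cmod q) by (unfold q; apply Cmod_minus_sym).
  assert (Hint : Cmod u1 < d).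
  { destruct Hu1 as [|Hu1]; auto. exfalso.
    specialize (Hmin (RtoC 0)). rewrite Cmod_0 in Hmin. specialize (Hmin ltac:(lra)).
    cbv beta in Hmin. replace (w0 + RtoC 0)%C with w0 in Hmin by ring.
    specialize (Hlin w1). unfold w1 in Hlin at 1 3 4. rewrite Hsub in Hlin. specialize (Hlin ltac:(lra)).
    pose proof (Cmod_minus_ge (l0 * u1)%C (f w1 - f w0)%C) as H1.
    rewrite (Cmod_minus_sym (l0 * u1)%C), Cmod_mult in H1.
    pose proof (Cmod_minus_triangle (f w1) y (f w0)) as H2.
    rewrite (Cmod_minus_sym (f w0) y) in Hmin. rewrite Hu1 in *. lra. }
  destruct (Hf w1) as [l1 [Hl1 Hd1]]; [unfold w1; rewrite Hsub; lra|].
  assert (HL1 : 0 < Cmod l1) by (apply Cmod_gt_0; auto).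
  destruct (proj1 (is_cderive_eps _ _ _) Hd1 (Cmod l1 / 2)) as [b [Hb Hlin1]]; [lra|].
  set (p := Cmod q / Cmod l1). assert (Hp : 0 < p) by (apply Rdiv_lt_0_compat; auto).
  assert (Hpq : Cmod l1 * p = Cmod q) by (unfold p; field; lra).
  assert (Hs : exists s, 0 < s <= 1 /\ s * p < b /\ s * p <= d - Cmod u1).
  { exists (Rmin 1 (Rmin (b / 2) (d - Cmod u1) / p)).
    assert (Hm : 0 < Rmin (b / 2) (d - Cmod u1)) by (apply Rmin_pos; lra).
    assert (Hmp : 0 < Rmin (b / 2) (d - Cmod u1) / p) by (apply Rdiv_lt_0_compat; auto).
    set (s := Rmin 1 _).
    assert (Hs1 : s <= 1) by apply Rmin_l.
    assert (Hs2 : s * p <= Rmin (b / 2) (d - Cmod u1)).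
    { apply Rle_trans with (Rmin (b / 2) (d - Cmod u1) / p * p).
      - apply Rmult_le_compat_r; [lra|apply Rmin_r].
      - right. field. lra. }
    pose proof (Rmin_l (b / 2) (d - Cmod u1)). pose proof (Rmin_r (b / 2) (d - Cmod u1)).
    split; [split; [apply Rmin_pos; lra|auto]|]. lra. }
  destruct Hs as [s [Hs [Hsb Hsd]]].
  set (v := (RtoC s * (q / l1))%C).
  assert (Hv : Cmod v = s * p).
  { unfold v, p. rewrite Cmod_mult, Cmod_div, Cmod_R, Rabs_pos_eq by (auto; lra). reflexivity. }
  assert (Huv : Cmod (u1 + v)%C <= d) by (pose proof (Cmod_triangle u1 v); lra).
  specialize (Hmin (u1 + v)%C Huv). cbv beta in Hmin.
  replace (w0 + (u1 + v))%C with (w1 + v)%C in Hmin by (unfold w1; ring).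
  specialize (Hlin1 (w1 + v)%C). replace (w1 + v - w1)%C with v in Hlin1 by ring.
  specialize (Hlin1 ltac:(lra)). rewrite Hv in Hlin1.
  assert (Hstep : Cmod (f (w1 + v)%C - y)%C <= (1 - s) * Cmod q + Cmod l1 / 2 * (s * p)).
  { replace (f (w1 + v)%C - y)%C with
      ((f (w1 + v)%C - f w1 - l1 * v) + - (RtoC (1 - s) * q))%C
      by (unfold v, q; rewrite RtoC_minus; field; auto).
    eapply Rle_trans; [apply Cmod_triangle|].
    rewrite Cmod_opp, Cmod_mult, Cmod_R, Rabs_pos_eq by lra. lra. }
  rewrite Hqe in Hmin. nra.
Qed.

Definition disk_inverse (f : C -> C) (y : C) : C :=
  epsilon (inhabits (RtoC 0)) (fun w => in_disk w /\ f w = y).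

Lemma disk_inverse_correct (f : C -> C) (w : C) :
  univalent_disk f -> in_disk w -> disk_inverse f (f w) = w.
Proof.
  intros [_ Hinj] Hw.
  destruct (epsilon_spec (inhabits (RtoC 0)) (fun v => in_disk v /\ f v = f w)) as [H1 H2].
  { exists w; auto. }
  apply Hinj; auto.
Qed.

Lemma classG_local_surjectivity (mu : C) (beta : R) (f : C -> C) (w : C) (eta : R) :
  mu <> RtoC 0 -> 0 < beta < 1 -> classG mu beta f -> in_disk w -> 0 < eta ->
  exists del, 0 < del /\ forall y, Cmod (y - f w)%C < del ->
    exists v, Cmod (v - w)%C < eta /\ in_disk v /\ f v = y.
Proof.
  intros Hmu Hb HG Hw Heta. set (e := Rmin eta (1 - Cmod w)).
  assert (He : 0 < e) by (apply Rmin_pos; unfold in_disk in Hw; lra).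
  assert (He1 : e <= eta) by apply Rmin_l. assert (He2 : e <= 1 - Cmod w) by apply Rmin_r.
  assert (Hin : forall v, Cmod (v - w)%C < e -> in_disk v).
  { intros v Hv. unfold in_disk. pose proof (Cmod_minus_ge v w). lra. }
  destruct (local_surjectivity f w e He) as [d [Hd H]].
  - intros v Hv. exists (C_derive f v). split.
    + apply (classG_derive_neq_0 mu beta); auto.
    + apply holomorphic_derive; auto. apply HG.
  - exists d; split; auto. intros y Hy. destruct (H y Hy) as [v [Hv Ev]].
    exists v. split; [lra|auto].
Qed.

Lemma is_cderive_disk_inverse (mu : C) (beta : R) (f : C -> C) (w : C) :
  mu <> RtoC 0 -> 0 < beta < 1 -> classG mu beta f -> in_disk w ->
  is_cderive (disk_inverse f) (f w) (RtoC 1 / C_derive f w)%C.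
Proof.
  intros Hmu Hb HG Hw. pose proof HG as [Hu _].
  destruct (classG_local_surjectivity mu beta f w 1 Hmu Hb HG Hw Rlt_0_1) as [d [Hd H]].
  apply (is_cderive_lift f (disk_inverse f) (fun y => y) (f w) _ _ d); auto.
  - intros y Hy. destruct (H y Hy) as [v [_ [Hv <-]]]. rewrite disk_inverse_correct; auto.
  - intros eps Heps.
    destruct (classG_local_surjectivity mu beta f w eps Hmu Hb HG Hw Heps) as [d' [Hd' H']].
    exists d'; split; auto. intros y Hy. destruct (H' y Hy) as [v [Hv [Hvd <-]]].
    rewrite !disk_inverse_correct; auto.
  - rewrite disk_inverse_correct by auto. apply holomorphic_derive; auto. apply Hu.
  - apply (classG_derive_neq_0 mu beta); auto.
  - apply is_cderive_id.
Qed.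


(** * Subordination *)

(** Put [kappa = z0 l / omega z0].  Moving
    inwards along [z0 * (1 + s * (-1 + i m))] the first-order parts of
    [|omega z| <= K |z|] give [Re kappa + m * Im kappa >= 1] for every real
    slope [m], so [kappa] is real and at least [1]. *)
Lemma jack_lemma (omega : C -> C) (z0 l : C) (K : R) :
  0 < K -> z0 <> RtoC 0 -> is_cderive omega z0 l -> Cmod (omega z0) = K * Cmod z0 ->
  (forall z, Cmod z <= Cmod z0 -> Cmod (omega z) <= K * Cmod z) ->
  exists k, 1 <= k /\ (z0 * l)%C = (RtoC k * omega z0)%C.
Proof.
  intros HK Hz0 Hd Hw Hle.
  assert (Hz : 0 < Cmod z0) by (apply Cmod_gt_0; auto).
  assert (HKz : 0 < K * Cmod z0) by (apply Rmult_lt_0_compat; auto).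
  assert (Hw0 : omega z0 <> RtoC 0) by (apply Cmod_gt_0; lra).
  set (kappa := (z0 * l / omega z0)%C).
  assert (Hslope : forall m, 1 <= Re kappa + m * Im kappa).
  { intros m. apply le_epsilon. intros eps Heps.
    set (N := Cmod (-1, m)). assert (HN : 1 <= N).
    { unfold N. pose proof (re_le_Cmod (-1, m)) as H. simpl in H.
      rewrite Rabs_left in H by lra. lra. }
    assert (Heta : 0 < eps * K / (2 * N))
      by (apply Rdiv_lt_0_compat; [apply Rmult_lt_0_compat; lra|lra]).
    destruct (proj1 (is_cderive_eps _ _ _) Hd _ Heta) as [d [Hdp Hlin]].
    set (s := Rmin (Rmin (1 / 2) (d / (2 * Cmod z0 * N))) (Rmin (1 / (m ^ 2 + 1)) (eps / (2 * (m ^ 2 + 1))))).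
    assert (Hm2 : 0 <= m ^ 2) by apply pow2_ge_0.
    assert (HzN : 0 < 2 * Cmod z0 * N) by (repeat apply Rmult_lt_0_compat; lra).
    assert (Hs : 0 < s) by (repeat apply Rmin_pos; try lra; apply Rdiv_lt_0_compat; lra).
    assert (S1 : s <= 1 / 2) by (unfold s; eapply Rle_trans; [apply Rmin_l|apply Rmin_l]).
    assert (S2 : s <= d / (2 * Cmod z0 * N)) by (unfold s; eapply Rle_trans; [apply Rmin_l|apply Rmin_r]).
    assert (S3 : s <= 1 / (m ^ 2 + 1)) by (unfold s; eapply Rle_trans; [apply Rmin_r|apply Rmin_l]).
    assert (S4 : s <= eps / (2 * (m ^ 2 + 1))) by (unfold s; eapply Rle_trans; [apply Rmin_r|apply Rmin_r]).
    assert (T2 : s * (Cmod z0 * N) < d).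
    { apply (Rmult_le_compat_r (Cmod z0 * N)) in S2; [|lra].
      replace (d / (2 * Cmod z0 * N) * (Cmod z0 * N)) with (d / 2) in S2 by (field; lra). lra. }
    assert (T3 : s * (m ^ 2 + 1) <= 1).
    { apply (Rmult_le_compat_r (m ^ 2 + 1)) in S3; [|lra].
      replace (1 / (m ^ 2 + 1) * (m ^ 2 + 1)) with 1 in S3 by (field; lra). lra. }
    assert (T4 : s * (m ^ 2 + 1) <= eps / 2).
    { apply (Rmult_le_compat_r (m ^ 2 + 1)) in S4; [|lra].
      replace (eps / (2 * (m ^ 2 + 1)) * (m ^ 2 + 1)) with (eps / 2) in S4 by (field; lra). lra. }
    clearbody s.
    set (xi := (RtoC s * (-1, m))%C).
    assert (Hxi : Cmod xi = s * N) by (unfold xi, N; rewrite Cmod_mult, Cmod_R, Rabs_pos_eq; lra).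
    assert (H1xi : Cmod (RtoC 1 + xi)%C <= 1 - s + m ^ 2 * s ^ 2).
    { assert (Hms : 0 <= m ^ 2 * s ^ 2) by (apply Rmult_le_pos; [lra|apply pow2_ge_0]).
      apply Rsqr_incr_0; [|apply Cmod_ge_0|lra].
      rewrite !Rsqr_pow2, Cmod_sqr. unfold xi. simpl Re. simpl Im.
      replace ((1 + (s * -1 - 0 * m)) ^ 2 + (0 + (s * m + 0 * -1)) ^ 2)
        with ((1 - s) ^ 2 + m ^ 2 * s ^ 2) by ring.
      set (q := m ^ 2 * s ^ 2) in *. nra. }
    assert (Hsm : m ^ 2 * s ^ 2 <= s) by (simpl in *; nra).
    set (z := (z0 * (RtoC 1 + xi))%C).
    assert (Hzz : (z - z0)%C = (z0 * xi)%C) by (unfold z; ring).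
    assert (Hzle : Cmod z <= Cmod z0) by (unfold z; rewrite Cmod_mult; nra).
    specialize (Hlin z). rewrite Hzz, Cmod_mult, Hxi in Hlin.
    specialize (Hlin ltac:(lra)). specialize (Hle z Hzle).
    replace (omega z - omega z0 - l * (z0 * xi))%C
      with (omega z - omega z0 * (RtoC 1 + kappa * xi))%C in Hlin
      by (unfold kappa; field; auto).
    pose proof (Cmod_minus_ge (omega z0 * (RtoC 1 + kappa * xi))%C (omega z)) as H2.
    rewrite (Cmod_minus_sym _ (omega z)), Cmod_mult, Hw in H2.
    unfold z in Hle at 2. rewrite Cmod_mult in Hle.
    assert (H3 : K * Cmod z0 * Cmod (RtoC 1 + kappa * xi)%C
      <= K * Cmod z0 * (1 - s + m ^ 2 * s ^ 2 + s * (eps / 2))).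
    { assert (E1 : eps * K / (2 * N) * (Cmod z0 * (s * N)) = K * Cmod z0 * (s * (eps / 2)))
        by (field; lra).
      rewrite E1 in Hlin.
      assert (K * (Cmod z0 * Cmod (RtoC 1 + xi)%C) <= K * Cmod z0 * (1 - s + m ^ 2 * s ^ 2)).
      { rewrite <- Rmult_assoc. apply Rmult_le_compat_l; lra. }
      lra. }
    apply Rmult_le_reg_l in H3; auto.
    pose proof (re_le_Cmod (RtoC 1 + kappa * xi)%C) as H4.
    pose proof (Rle_abs (Re (RtoC 1 + kappa * xi)%C)) as H5.
    assert (H6 : Re (RtoC 1 + kappa * xi)%C = 1 - s * (Re kappa + m * Im kappa)).
    { unfold xi. destruct kappa. simpl. ring. }
    rewrite H6 in H4, H5.
    assert (H7 : s * (1 - m ^ 2 * s - eps / 2) <= s * (Re kappa + m * Im kappa)) by (simpl in *; lra).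
    apply Rmult_le_reg_l in H7; auto. lra. }
  assert (Him : Im kappa = 0).
  { apply NNPP. intro Hne. specialize (Hslope (- Re kappa / Im kappa)).
    replace (- Re kappa / Im kappa * Im kappa) with (- Re kappa) in Hslope by (field; auto). lra. }
  exists (Re kappa). split.
  - specialize (Hslope 0). lra.
  - replace (RtoC (Re kappa)) with kappa.
    + unfold kappa. field; auto.
    + destruct kappa as [a b]. simpl in *. subst. reflexivity.
Qed.

Definition attained (mu : C) (beta K : R) (f : C -> C) (z : C) : Prop :=
  exists w, Cmod w <= K * Cmod z /\ f w = f0 mu beta z.

(** At the origin [|f0'| = beta |mu| <= |f'|], and [K > 1] leaves room for the
    error terms. *)
Lemma attained_near_0 (mu : C) (beta K : R) (f : C -> C) :
  mu <> RtoC 0 -> 0 < beta < 1 -> classG mu beta f -> 1 < K ->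
  exists del, 0 < del /\ forall z, Cmod z < del -> attained mu beta K f z.
Proof.
  intros Hmu Hb HG HK. pose proof HG as [[Hf _] [Hf0 _]].
  assert (H0d : in_disk (RtoC 0)) by (unfold in_disk; rewrite Cmod_0; lra).
  set (B := beta * Cmod mu).
  assert (HB : 0 < B) by (apply Rmult_lt_0_compat; [lra|apply Cmod_gt_0; auto]).
  pose proof (classG_derive_0 mu beta f Hmu Hb HG) as HfB. fold B in HfB.
  (* eta is chosen so that (B + eta) / (B - eta) = K. *)
  set (eta := B * (K - 1) / (K + 1)).
  assert (Heta : 0 < eta) by (apply Rdiv_lt_0_compat; [apply Rmult_lt_0_compat|]; lra).
  assert (HetaK : B + eta = K * (B - eta)) by (unfold eta; field; lra).
  assert (HetaB : 0 < B - eta) by nra.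
  destruct (proj1 (is_cderive_eps _ _ _) (holomorphic_derive f _ Hf H0d) eta Heta) as [d1 [Hd1 H1]].
  pose proof (is_cderive_f0 mu beta (RtoC 0) H0d) as Hg.
  destruct (proj1 (is_cderive_eps _ _ _) Hg eta Heta) as [d2 [Hd2 H2]].
  destruct (classG_local_surjectivity mu beta f (RtoC 0) d1 Hmu Hb HG H0d Hd1) as [d3 [Hd3 H3]].
  destruct (is_cderive_ccont _ _ _ Hg d3 Hd3) as [d4 [Hd4 H4]].
  rewrite f0_at_0 in *. rewrite Hf0 in *.
  exists (Rmin d2 d4). split; [apply Rmin_pos; auto|]. intros z Hz.
  pose proof (Rmin_l d2 d4). pose proof (Rmin_r d2 d4).
  assert (Hz0 : (z - RtoC 0)%C = z) by ring.
  specialize (H2 z). rewrite Hz0 in H2. specialize (H2 ltac:(lra)).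
  specialize (H4 z). rewrite Hz0 in H4. specialize (H4 ltac:(lra)).
  destruct (H3 _ H4) as [w [Hw [_ Ew]]]. exists w. split; auto.
  specialize (H1 w Hw). replace (w - RtoC 0)%C with w in H1 by ring. rewrite Ew in H1.
  set (g := (f0 mu beta z - RtoC 1)%C) in *.
  pose proof (Cmod_minus_ge (C_derive f (RtoC 0) * w)%C g) as H5.
  rewrite Cmod_minus_sym, Cmod_mult in H5.
  set (c := (- (mu * RtoC beta) / (RtoC 1 - RtoC 0) * RtoC 1)%C) in *.
  pose proof (Cmod_minus_ge g (c * z)%C) as H6. rewrite Cmod_mult in H6.
  assert (Hc : Cmod c = B).
  { unfold c. replace (- (mu * RtoC beta) / (RtoC 1 - RtoC 0) * RtoC 1)%C with (- (mu * RtoC beta))%C.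
    - rewrite Cmod_opp, Cmod_mult, Cmod_R, Rabs_pos_eq by lra. unfold B. ring.
    - field. }
  rewrite Hc in H6. pose proof (Cmod_ge_0 w).
  assert (HBw : B * Cmod w <= Cmod (C_derive f (RtoC 0)) * Cmod w) by (apply Rmult_le_compat_r; auto).
  assert (HBK : (B - eta) * Cmod w <= (B - eta) * (K * Cmod z)).
  { replace ((B - eta) * (K * Cmod z)) with ((B + eta) * Cmod z) by (rewrite HetaK; ring). lra. }
  apply Rmult_le_reg_l in HBK; auto.
Qed.

(** The inequality [|w| <= K |z|] is never an equality on the first circle
    where it could be one: Jack's lemma would give [k >= 1] with
    [z0 f0' z0 = k * w0 f' w0], excluded by [logarithmic_derivative_avoids]
    with [m = 1 / k]. *)
Lemma attained_strictly (mu : C) (beta K : R) (f : C -> C) (z0 : C) :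
  mu <> RtoC 0 -> 0 < beta < 1 -> classG mu beta f -> 1 < K ->
  z0 <> RtoC 0 -> K * Cmod z0 < 1 ->
  (forall z, Cmod z <= Cmod z0 -> attained mu beta K f z) ->
  exists w, Cmod w < K * Cmod z0 /\ f w = f0 mu beta z0.
Proof.
  intros Hmu Hb HG HK Hz0 HKz Hatt. pose proof HG as [Hu [_ [Hne _]]].
  assert (Hz0p : 0 < Cmod z0) by (apply Cmod_gt_0; auto).
  assert (Hz0d : in_disk z0) by (unfold in_disk; nra).
  assert (Hdisk : forall z w, Cmod z <= Cmod z0 -> Cmod w <= K * Cmod z -> in_disk w)
    by (intros z w Hz Hw; unfold in_disk; nra).
  destruct (Hatt z0 (Rle_refl _)) as [w0 [Hw0 Ew0]].
  assert (Hw0d : in_disk w0) by (apply (Hdisk z0); auto; lra).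
  destruct Hw0 as [Hw0|Hw0]; [exists w0; auto|]. exfalso.
  set (omega := fun z => disk_inverse f (f0 mu beta z)).
  assert (Hom : forall z, Cmod z <= Cmod z0 -> Cmod (omega z) <= K * Cmod z).
  { intros z Hz. destruct (Hatt z Hz) as [w [Hw Ew]]. unfold omega.
    rewrite <- Ew, disk_inverse_correct; auto. apply (Hdisk z); auto. }
  assert (Hom0 : omega z0 = w0) by (unfold omega; rewrite <- Ew0; apply disk_inverse_correct; auto).
  pose proof (is_cderive_disk_inverse mu beta f w0 Hmu Hb HG Hw0d) as Hinv.
  rewrite Ew0 in Hinv.
  pose proof (is_cderive_comp (disk_inverse f) (f0 mu beta) z0 _ _ Hinv
    (is_cderive_f0 mu beta z0 Hz0d)) as Hder.
  destruct (jack_lemma omega z0 _ K ltac:(lra) Hz0 Hder ltac:(rewrite Hom0; auto) Hom) as [k [Hk Ek]].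
  rewrite Hom0 in Ek.
  assert (Hfn : f w0 <> RtoC 0) by auto.
  assert (Hdn : C_derive f w0 <> RtoC 0) by (apply (classG_derive_neq_0 mu beta); auto).
  pose proof (one_minus_disk_neq0 z0 Hz0d) as Hz1.
  assert (Hkne : RtoC k <> RtoC 0) by (intro E; injection E; lra).
  rewrite <- Ew0 in Ek.
  apply (logarithmic_derivative_avoids mu beta (/ k) f w0 z0 Hmu Hb HG Hw0d Hz0d).
  - rewrite Hw0. nra.
  - split; [apply Rlt_le, Rinv_0_lt_compat; lra|].
    rewrite <- Rinv_1. apply Rinv_le_contravar; lra.
  - replace (w0 * C_derive f w0 / (mu * f w0))%C
      with (RtoC k * w0 * (C_derive f w0 / (RtoC k * mu * f w0)))%C by (field; auto).
    rewrite <- Ek. rewrite RtoC_mult, RtoC_inv by lra. field. repeat split; auto.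
Qed.

(** The radii up to which [attained] holds form a set which is closed (by
    compactness of the disk of radius [K t]) and open (a strict inequality
    persists nearby, and the circle is compact), so it exhausts [0, 1 / K). *)
Lemma attained_on_disk (mu : C) (beta K : R) (f : C -> C) :
  mu <> RtoC 0 -> 0 < beta < 1 -> classG mu beta f -> 1 < K ->
  forall z, K * Cmod z < 1 -> attained mu beta K f z.
Proof.
  intros Hmu Hb HG HK z Hz. pose proof HG as [[Hf _] [Hf0 _]].
  set (P := fun t => forall z, Cmod z <= t -> attained mu beta K f z).
  cut (P (Cmod z)); [intros H; apply H; lra|].
  apply NNPP. intro Hbad.
  assert (HPd : forall s t, s <= t -> P t -> P s) by (intros s t Hst Ht v Hv; apply Ht; lra).
  assert (H0 : P 0).
  { intros v Hv. assert (v = RtoC 0) as -> by (apply Cmod_eq_0; pose proof (Cmod_ge_0 v); lra).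
    exists (RtoC 0). rewrite Cmod_0, f0_at_0. split; [lra|auto]. }
  destruct (completeness (fun t => 0 <= t /\ P t)) as [T [HT1 HT2]].
  { exists (Cmod z). intros t [_ Ht]. apply Rnot_lt_le. intro Hlt. apply Hbad.
    apply HPd with t; auto. lra. }
  { exists 0. split; [lra|auto]. }
  assert (HT0 : 0 <= T) by (apply HT1; split; [lra|auto]).
  assert (HTz : T <= Cmod z).
  { apply HT2. intros t [_ Ht]. apply Rnot_lt_le. intro Hlt. apply Hbad. apply HPd with t; auto. lra. }
  assert (HKT : K * T < 1) by nra.
  assert (Hlt : forall t, t < T -> P t).
  { intros t Ht. apply NNPP. intro Hn.
    assert (T <= t); [|lra]. apply HT2. intros s [_ Hs]. apply Rnot_lt_le. intro. apply Hn.
    apply HPd with s; auto. lra. }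
  assert (HPT : P T).
  { intros v Hv. destruct Hv as [Hv|Hv]; [apply (Hlt (Cmod v)); lra|].
    destruct HT0 as [HT0|HT0]; [|apply H0; lra].
    assert (HKTp : 0 < K * T) by (apply Rmult_lt_0_compat; lra).
    assert (Hvd : in_disk v) by (unfold in_disk; nra).
    destruct (disk_max (fun w => - Cmod (f w - f0 mu beta v)%C) (K * T) HKTp) as [w [Hw Hmin]].
    { intros w Hw eps Heps. assert (Hwd : in_disk w) by (unfold in_disk; lra).
      destruct (is_cderive_ccont _ _ _ (holomorphic_derive f w Hf Hwd) eps Heps) as [d [Hd Hc]].
      exists d; split; auto. intros u _ Hu. specialize (Hc u Hu).
      pose proof (Cmod_minus_triangle (f w) (f u) (f0 mu beta v)) as H.
      rewrite (Cmod_minus_sym (f w) (f u)) in H. lra. }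
    exists w. rewrite Hv. split; auto. apply Cmod_small_eq. intros e He. apply Rnot_lt_le. intro Hgt.
    destruct (is_cderive_ccont _ _ _ (is_cderive_f0 mu beta v Hvd) e He) as [d [Hd Hc]].
    set (s := Rmin (1 / 2) (d / 2)). assert (Hs : 0 < s) by (apply Rmin_pos; lra).
    assert (Hs1 : s <= 1 / 2) by apply Rmin_l. assert (Hs2 : s <= d / 2) by apply Rmin_r.
    set (v' := (RtoC (1 - s) * v)%C).
    assert (Hv' : Cmod v' = (1 - s) * T)
      by (unfold v'; rewrite Cmod_mult, Cmod_R, Rabs_pos_eq by lra; rewrite Hv; auto).
    assert (Hvv : Cmod (v' - v)%C < d).
    { replace (v' - v)%C with (- (RtoC s * v))%C by (unfold v'; rewrite RtoC_minus; ring).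
      rewrite Cmod_opp, Cmod_mult, Cmod_R, Rabs_pos_eq, Hv by lra. nra. }
    specialize (Hc v' Hvv).
    destruct (Hlt (Cmod v') ltac:(rewrite Hv'; nra) v' (Rle_refl _)) as [w' [Hw' Ew']].
    assert (Hw'T : Cmod w' <= K * T) by (rewrite Hv' in Hw'; nra).
    specialize (Hmin w' Hw'T). cbv beta in Hmin. rewrite Ew' in Hmin. lra. }
  assert (Hext : exists del, 0 < del /\ P (T + del)).
  { destruct HT0 as [HT0|HT0].
    2: { destruct (attained_near_0 mu beta K f Hmu Hb HG HK) as [d [Hd H]].
         exists (d / 2). split; [lra|]. intros v Hv. apply H. lra. }
    destruct (disk_uniform T (fun u d => forall v, Cmod (v - u)%C < d -> attained mu beta K f v))
      as [d [Hd Huni]]; auto.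
    { intros u d d' Hdd H v Hv. apply H. lra. }
    { intros u Hu.
      assert (Hball : exists d, 0 < d /\ forall v, Cmod (v - u)%C < d -> attained mu beta K f v).
      { destruct Hu as [Hu|Hu].
        - exists (T - Cmod u). split; [lra|]. intros v Hv. apply HPT.
          pose proof (Cmod_minus_ge v u). lra.
        - assert (Hune : u <> RtoC 0) by (apply Cmod_gt_0; lra).
          assert (Hud : in_disk u) by (unfold in_disk; nra).
          destruct (attained_strictly mu beta K f u) as [w [Hw Ew]]; auto.
          { rewrite Hu; auto. }
          { rewrite Hu; auto. }
          assert (Hwd : in_disk w) by (unfold in_disk; rewrite Hu in Hw; lra).
          set (eta := (K * Cmod u - Cmod w) / 2). assert (Heta : 0 < eta) by (unfold eta; lra).
          destruct (classG_local_surjectivity mu beta f w eta Hmu Hb HG Hwd Heta) as [d1 [Hd1 H1]].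
          destruct (is_cderive_ccont _ _ _ (is_cderive_f0 mu beta u Hud) d1 Hd1) as [d2 [Hd2 H2]].
          assert (HeK : 0 < eta / K) by (apply Rdiv_lt_0_compat; lra).
          exists (Rmin d2 (eta / K)). split; [apply Rmin_pos; auto|]. intros v Hv.
          pose proof (Rmin_l d2 (eta / K)). pose proof (Rmin_r d2 (eta / K)).
          specialize (H2 v ltac:(lra)). rewrite <- Ew in H2.
          destruct (H1 _ H2) as [x [Hx [_ Ex]]]. exists x. split; auto.
          pose proof (Cmod_minus_ge x w). pose proof (Cmod_minus_ge u v) as H5.
          rewrite Cmod_minus_sym in H5.
          assert (H6 : K * (Cmod u - Cmod v) <= K * (eta / K)) by (apply Rmult_le_compat_l; lra).
          replace (K * (eta / K)) with eta in H6 by (field; lra).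
          unfold eta in *. lra. }
      destruct Hball as [d [Hd H]]. exists (d / 2). split; [lra|].
      intros v _ Hvu x Hx. apply H.
      pose proof (Cmod_minus_triangle x v u). lra. }
    exists (d / 2). split; [lra|]. intros v Hv.
    destruct (Rle_lt_dec (Cmod v) T) as [|HvT]; [apply HPT; auto|].
    (* The radial projection of v to the circle is at distance |v| - T from v. *)
    apply (Huni (RtoC (T / Cmod v) * v)%C).
    - rewrite Cmod_mult, Cmod_R, Rabs_pos_eq
        by (apply Rlt_le, Rdiv_lt_0_compat; lra). right. field. lra.
    - assert (Hr : 0 < 1 - T / Cmod v) by (assert (T / Cmod v < 1) by (apply Rdiv_lt_iff; lra); lra).
      replace (v - RtoC (T / Cmod v) * v)%C with (RtoC (1 - T / Cmod v) * v)%C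
        by (rewrite RtoC_minus; ring).
      rewrite Cmod_mult, Cmod_R, Rabs_pos_eq by lra.
      replace ((1 - T / Cmod v) * Cmod v) with (Cmod v - T) by (field; lra). lra. }
  destruct Hext as [del [Hdel HPdel]].
  assert (T + del <= T); [|lra]. apply HT1. split; [lra|auto].
Qed.

Lemma f0_subordinate (mu : C) (beta : R) (f : C -> C) :
  mu <> RtoC 0 -> 0 < beta < 1 -> classG mu beta f -> subordinate (f0 mu beta) f.
Proof.
  intros Hmu Hb HG. pose proof HG as [Hu _].
  split; [apply f0_holomorphic|split; [apply Hu|]].
  set (omega := fun z => disk_inverse f (f0 mu beta z)). exists omega.
  assert (HK : forall z K, 1 < K -> K * Cmod z < 1 ->
    Cmod (omega z) <= K * Cmod z /\ f (omega z) = f0 mu beta z).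
  { intros z K HK Hz. destruct (attained_on_disk mu beta K f Hmu Hb HG HK z Hz) as [w [Hw Ew]].
    assert (Hom : omega z = w).
    { unfold omega. rewrite <- Ew. apply disk_inverse_correct; auto. unfold in_disk. lra. }
    rewrite Hom. auto. }
  assert (Hmod : forall z, in_disk z ->
    Cmod (omega z) <= Cmod z /\ f (omega z) = f0 mu beta z).
  { intros z Hz. unfold in_disk in Hz. pose proof (Cmod_ge_0 z).
    assert (Hsmall : forall eps, 0 < eps <= 1 - Cmod z ->
      Cmod (omega z) <= Cmod z + eps / 2 /\ f (omega z) = f0 mu beta z).
    { intros eps Heps. destruct (HK z (1 + eps / 2)) as [H1 H2]; [lra|nra|]. split; [nra|auto]. }
    split.
    - apply le_epsilon. intros eps Heps.
      pose proof (Rmin_l eps (1 - Cmod z)). pose proof (Rmin_r eps (1 - Cmod z)).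
      assert (0 < Rmin eps (1 - Cmod z)) by (apply Rmin_pos; lra).
      destruct (Hsmall (Rmin eps (1 - Cmod z))) as [H4 _]; lra.
    - apply (Hsmall (1 - Cmod z)). lra. }
  repeat split.
  - intros z Hz. destruct (Hmod z Hz) as [H1 H2].
    assert (Hw : in_disk (omega z)) by (unfold in_disk in *; lra).
    pose proof (is_cderive_disk_inverse mu beta f (omega z) Hmu Hb HG Hw) as Hinv.
    rewrite H2 in Hinv.
    eexists. apply (is_cderive_comp (disk_inverse f) (f0 mu beta)); [exact Hinv|].
    apply is_cderive_f0; auto.
  - intros z Hz. apply Hmod; auto.
  - intros z Hz. symmetry. apply Hmod; auto.
Qed.

Lemma f0_beta_0 (mu z : C) : f0 mu 0 z = RtoC 1.
Proof.
  unfold f0, pow_one_minus. replace (mu * RtoC 0 * Clog (RtoC 1 - z))%C with (RtoC 0) by ring.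
  apply Cexp_0.
Qed.

Lemma const_1_subordinate (mu : C) (g : C -> C) :
  holomorphic_disk g -> g (RtoC 0) = RtoC 1 -> subordinate (f0 mu 0) g.
Proof.
  intros Hg Hg0. split; [apply f0_holomorphic|split; [exact Hg|]].
  exists (fun _ => RtoC 0). repeat split.
  - intros z _. eexists. apply is_cderive_const.
  - intros z _. rewrite Cmod_0. apply Cmod_ge_0.
  - intros z _. rewrite f0_beta_0, Hg0. reflexivity.
Qed.

Lemma Cmod_Clog_one_minus (r : R) : 0 < r < 1 ->
  exists M, forall w, Cmod w <= r -> Cmod (Clog (RtoC 1 - w)) <= M.
Proof.
  intros Hr. destruct (disk_max (fun w => Cmod (Clog (RtoC 1 - w))) r) as [w [_ H]]; [lra| |].
  - intros z Hz eps Heps. assert (Hzd : in_disk z) by (unfold in_disk; lra).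
    destruct (ccont_Clog (RtoC 1 - z)%C (one_minus_disk_Re z Hzd) eps Heps) as [d [Hd Hc]].
    exists d; split; auto. intros u _ Hu. specialize (Hc (RtoC 1 - u)%C).
    replace (RtoC 1 - u - (RtoC 1 - z))%C with (- (u - z))%C in Hc by ring.
    rewrite Cmod_opp in Hc. specialize (Hc Hu).
    pose proof (Cmod_minus_ge (Clog (RtoC 1 - u)) (Clog (RtoC 1 - z))). lra.
  - exists (Cmod (Clog (RtoC 1 - w))). exact H.
Qed.

(** For [beta = 0] the class contains every [f0 mu b] with [0 < b < 1], and
    [f0 mu b] tends to [1] uniformly on compact subsets as [b] tends to [0]. *)
Lemma subordinate_to_all_const_1 (mu : C) (g : C -> C) :
  Omega mu -> (forall f, classG mu 0 f -> subordinate g f) ->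
  forall z, in_disk z -> g z = RtoC 1.
Proof.
  intros HO Hall z Hz. unfold in_disk in Hz. pose proof (Cmod_ge_0 z) as Hz0.
  destruct (Cmod_Clog_one_minus ((1 + Cmod z) / 2)) as [M HM]; [lra|].
  assert (Hmu : 0 < Cmod mu) by (apply Cmod_gt_0, HO).
  assert (HM0 : 0 <= M).
  { eapply Rle_trans; [apply (Cmod_ge_0 (Clog (RtoC 1 - RtoC 0)))|]. apply HM. rewrite Cmod_0. lra. }
  apply Cmod_small_eq. intros eps Heps.
  destruct (is_cderive_ccont _ _ _ is_cderive_Cexp_0 eps Heps) as [d [Hd Hc]].
  assert (HmM : 0 < Cmod mu * (M + 1)) by (apply Rmult_lt_0_compat; lra).
  set (b := Rmin (1 / 2) (d / (Cmod mu * (M + 1)))).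
  assert (Hb : 0 < b) by (apply Rmin_pos; [lra|apply Rdiv_lt_0_compat; auto]).
  assert (Hb1 : b <= 1 / 2) by apply Rmin_l.
  assert (Hb2 : b * (Cmod mu * (M + 1)) <= d).
  { apply Rle_trans with (d / (Cmod mu * (M + 1)) * (Cmod mu * (M + 1))).
    - apply Rmult_le_compat_r; [lra|apply Rmin_r].
    - right. field. split; lra. }
  destruct (Hall (f0 mu b)) as [_ [_ [omega [_ [Hom Hg]]]]].
  { apply classG_monotone with b; [lra|]. apply f0_classG; auto. lra. }
  rewrite (Hg z Hz). specialize (Hom z Hz).
  specialize (HM (omega z) ltac:(lra)).
  rewrite Cexp_0 in Hc. unfold f0, pow_one_minus. apply Rlt_le, Hc.
  replace (mu * RtoC b * Clog (RtoC 1 - omega z) - RtoC 0)%C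
    with (mu * RtoC b * Clog (RtoC 1 - omega z))%C by ring.
  rewrite !Cmod_mult, Cmod_R, (Rabs_pos_eq b) by lra.
  assert (0 < b * Cmod mu) by (apply Rmult_lt_0_compat; auto). nra.
Qed.

(* The second conjunct needs [0 < beta]: for [beta = 0] the function [f0] is
   the constant 1, which is not univalent.  The third conjunct is sharpness,
   for all beta in [0,1): no subordinant common to the whole class is better
   than [f0]. *)
Theorem theorem3p1 (mu : C) (beta : R) :
  Omega mu -> (0 <= beta < 1)%R ->
  (forall f : C -> C, classG mu beta f -> subordinate (f0 mu beta) f) /\
  ((0 < beta)%R -> classG mu beta (f0 mu beta)) /\
  (forall g : C -> C, holomorphic_disk g ->
     (forall f : C -> C, classG mu beta f -> subordinate g f) ->
     subordinate g (f0 mu beta)).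
Proof.
  intros HO [Hb0 Hb1]. assert (Hmu : mu <> RtoC 0) by apply HO.
  split; [|split].
  - intros f HG. destruct Hb0 as [Hb0 | <-]; [apply f0_subordinate; auto|].
    destruct HG as [[Hf _] [Hf0 _]]. apply const_1_subordinate; auto.
  - intros Hb. apply f0_classG; auto.
  - intros g Hg Hall. destruct Hb0 as [Hb0 | <-]; [apply Hall, f0_classG; auto|].
    pose proof (subordinate_to_all_const_1 mu g HO Hall) as H1.
    split; [exact Hg|split; [apply f0_holomorphic|]].
    exists (fun _ => RtoC 0). repeat split.
    + intros z _. eexists. apply is_cderive_const.
    + intros z _. rewrite Cmod_0. apply Cmod_ge_0.
    + intros z Hz. rewrite f0_beta_0. apply H1; auto.
Qed.
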